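(* Let $\mathcal L$ be a finite-dimensional complex vector space and $F$ a homogeneous polynomial on $\mathcal L$. There is a bijection between the irreducible projective varieties $X\subseteq\mathbb P(\mathcal L)$ with $\mathrm{MLD}_F(X)=1$ and the solutions $\Phi$ of the homaloidal PDE for $(\mathcal L,F)$. It sends $X$ to $\Phi:=F\circ\mathrm{MLE}_{X,\mathcal L,F}$, and sends $\Phi$ to $X:=\mathbb P\big(\overline{\mathrm{Im}(-\nabla\log\Phi)}\big)$ (Zariski closure). Corresponding $X$ and $\Phi$ satisfy $\mathrm{MLE}_{X,\mathcal L,F}=-\nabla\log\Phi$.
   Context: Let $\mathcal L$ be a finite-dimensional complex vector space with dual $\mathcal L^*$. For a polynomial $F$ on $\mathcal L$, $\mathbf u\in\mathcal L^*$, $p\in\mathcal L\setminus V(F)$, the log-likelihood is $\ell_{F,\mathbf u}(p)=\log F(p)-\mathbf u(p)$ (gradient $\nabla_pF/F(p)-\mathbf u$). For an irreducible affine variety $Y\subseteq\mathcal L$, $\mathrm{MLD}_F(Y)$ is the number of $p\in Y^{\mathrm{sm}}\setminus V(F)$ with $T_pY\subseteq\ker(\nabla_p\ell_{F,\mathbf u})$ for general $\mathbf u$. For an irreducible projective $X\subseteq\mathbb P(\mathcal L)$ with affine cone $C_X$ and homogeneous $F$, $\mathrm{MLD}_F(X):=\mathrm{MLD}_F(C_X)$. When $\mathrm{MLD}_F(X)=1$, $\mathrm{MLE}_{X,\mathcal L,F}:\mathcal L^*\dashrightarrow C_X^{\mathrm{sm}}\setminus V(F)$ sends a general $\mathbf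 u$ to the unique critical point of $\ell_{F,\mathbf u}$ along $C_X$. The homaloidal PDE for $(\mathcal L,F)$: a solution is a homogeneous rational function $\Phi:\mathcal L^*\dashrightarrow\mathbb C$ with $\Phi=F\circ(-\nabla\log\Phi)$, where $\nabla\log\Phi:\mathcal L^*\dashrightarrow(\mathcal L^* )^*=\mathcal L$ is the gradient. Rational functions agreeing on a dense open set are identified. *)

(* Defs.v *)
From HB Require Import structures.
From mathcomp Require Import all_boot all_order all_algebra.
From mathcomp Require Import reals complex.
From mathcomp Require Import mpoly.
Set Implicit Arguments. Unset Strict Implicit. Unset Printing Implicit Defensive.
Import Order.TTheory GRing.Theory Num.Theory.
Local Open Scope ring_scope.

(* Throughout: the complex numbers are R[i] for a real field R : realType
   (so C = R[i] is isomorphic to the field of complex numbers);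
   L = C^n, points of L and of L^* are functions 'I_n -> C, and
   u(p) = \sum_i u_i p_i is the standard pairing.  Polynomials on L (and on
   the dual) are elements of {mpoly C[n]}. *)

Section Defs.
Variables (R : realType) (n : nat).
Local Notation C := R[i].
Local Notation pt := ('I_n -> C).
Local Notation poly := {mpoly C[n]}.

Definition homogeneous (d : nat) (p : poly) : Prop :=
  forall m, m \in msupp p -> mdeg m = d.

Definition pairing (u p : pt) : C := \sum_(i < n) u i * p i.

Definition grad (f : poly) (p : pt) : pt := fun i => (f^`M(i)).@[p].

Definition zero_set (S : poly -> Prop) : pt -> Prop :=
  fun p => forall f, S f -> f.@[p] = 0.
Definition zclosed (Y : pt -> Prop) : Prop :=
  exists S : poly -> Prop, forall p, Y p <-> zero_set S p.
Definition vanishing (Y : pt -> Prop) : poly -> Prop :=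
  fun f => forall p, Y p -> f.@[p] = 0.
Definition zclosure (S : pt -> Prop) : pt -> Prop := zero_set (vanishing S).

Definition subset (A B : pt -> Prop) : Prop := forall p, A p -> B p.

Definition irreducible_closed (Y : pt -> Prop) : Prop :=
  zclosed Y /\ (exists p, Y p) /\
  forall Z1 Z2, zclosed Z1 -> zclosed Z2 ->
    subset Y (fun p => Z1 p \/ Z2 p) -> subset Y Z1 \/ subset Y Z2.

Definition has_chain (k : nat) (Y : pt -> Prop) : Prop :=
  exists Z : nat -> pt -> Prop,
    (forall j, (j <= k)%N -> irreducible_closed (Z j) /\ subset (Z j) Y) /\
    (forall j, (j < k)%N -> subset (Z j) (Z j.+1) /\
                             exists p, Z j.+1 p /\ ~ Z j p).
Definition var_dim (Y : pt -> Prop) (d : nat) : Prop :=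
  has_chain d Y /\ ~ has_chain d.+1 Y.

Definition tangent_space (Y : pt -> Prop) (p : pt) : pt -> Prop :=
  fun v => forall f, vanishing Y f -> pairing (grad f p) v = 0.

Definition has_indep (k : nat) (W : pt -> Prop) : Prop :=
  exists A : 'M[C]_(k, n), \rank A = k /\ forall j : 'I_k, W (fun i => A j i).
Definition lin_dim (W : pt -> Prop) (d : nat) : Prop :=
  has_indep d W /\ ~ has_indep d.+1 W.

Definition smooth_point (Y : pt -> Prop) (p : pt) : Prop :=
  Y p /\ exists d, var_dim Y d /\ lin_dim (tangent_space Y p) d.

(* affine cones of irreducible projective varieties X in P(L): irreducible
   closed subsets of L stable under scaling *)
Definition irr_cone (Y : pt -> Prop) : Prop :=
  irreducible_closed Y /\ forall (t : C) p, Y p -> Y (fun i => t * p i).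

Definition general (P : pt -> Prop) : Prop :=
  exists g : poly, g != 0 /\ forall u, g.@[u] != 0 -> P u.

Definition grad_loglik (F : poly) (u p : pt) : pt :=
  fun i => grad F p i / F.@[p] - u i.

Definition critical (F : poly) (Y : pt -> Prop) (u p : pt) : Prop :=
  smooth_point Y p /\ F.@[p] != 0 /\
  forall v, tangent_space Y p v -> pairing (grad_loglik F u p) v = 0.

Definition MLD_one (F : poly) (Y : pt -> Prop) : Prop :=
  general (fun u => exists p, critical F Y u p /\
                              forall q, critical F Y u q -> q = p).

(* homogeneous rational functions Phi = P / Q on L^*, P, Q homogeneous,
   nonzero (Phi <> 0 so that log Phi makes sense) *)
Definition homog_ratfun (Phi : poly * poly) : Prop :=
  Phi.1 != 0 /\ Phi.2 != 0 /\
  (exists d1, homogeneous d1 Phi.1) /\ (exists d2, homogeneous d2 Phi.2).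

Definition rdef (Phi : poly * poly) (u : pt) : Prop :=
  Phi.1.@[u] * Phi.2.@[u] != 0.
Definition rval (Phi : poly * poly) (u : pt) : C := Phi.1.@[u] / Phi.2.@[u].
Definition neg_grad_log (Phi : poly * poly) (u : pt) : pt :=
  fun i => - (grad Phi.1 u i / Phi.1.@[u] - grad Phi.2 u i / Phi.2.@[u]).

Definition homaloidal_sol (F : poly) (Phi : poly * poly) : Prop :=
  homog_ratfun Phi /\
  general (fun u => rdef Phi u /\ rval Phi u = F.@[neg_grad_log Phi u]).

Definition image_ngl (Phi : poly * poly) : pt -> Prop :=
  fun p => exists u, rdef Phi u /\ p = neg_grad_log Phi u.

End Defs.

(* Main.v *)
Require Import Defs.
From HB Require Import structures.
From mathcomp Require Import all_boot all_order all_algebra.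
From mathcomp Require Import reals complex.
From mathcomp Require Import mpoly.
From mathcomp Require Import boolp generic_quotient closed_field ring.
Set Implicit Arguments. Unset Strict Implicit. Unset Printing Implicit Defensive.
Import Order.TTheory GRing.Theory Num.Theory.
Local Open Scope ring_scope.

(* Everything is reduced to linear algebra over the field K = C(u_1, ..., u_n)
   with its derivations d_j.  In characteristic 0, algebraically independent
   elements of K have independent differentials, so the closure of the image of
   a rational map phi has, at a general point, the image of d phi as tangent
   space, and its dimension is the rank of d phi.

   Let Phi be a solution and phi = - grad log Phi.  The pairing of u with
   phi(u) is constant, and differentiating it together with Phi = F o phi shows
   that grad log F (phi u) - u is orthogonal to the image of d phi: phi(u) is
   critical.  As d phi is symmetric, a vector field grad f (phi), f vanishing on
   the image, is annihilated by d phi and is constant along its own flow, so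
   phi is constant on u + (conormal space at phi u).  By density, every critical
   point q for u satisfies the equation q = phi(u).

   Conversely, if MLD_F(Y) = 1, the maximum likelihood estimator is definable
   in the first-order theory of algebraically closed fields; by quantifier
   elimination and characteristic 0 it is a rational map phi.  Differentiating
   u = grad log F (phi u) - (a conormal vector at phi u) gives
   n <= rank d phi + codim Y, so phi is dominant, and Euler's identity on the
   cone Y gives phi = - grad log (F o phi). *)

Local Notation "x %:F" := (@FracField.tofrac _ x) (format "x %:F").
Local Notation subset := Defs.subset.

(** * Multivariate polynomials *)

Section MpolyBasics.
Variables (C : numFieldType) (n : nat).
Implicit Types p q : {mpoly C[n]}.

Lemma mpoly_ring_ind (P : {mpoly C[n]} -> Prop) :
  (forall c, P c%:MP) -> (forall i, P 'X_i) ->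
  (forall p q, P p -> P q -> P (p + q)) ->
  (forall p q, P p -> P q -> P (p * q)) -> forall p, P p.
Proof.
move=> PC PX PD PM p; rewrite (mpolyE p).
elim/big_ind: _ => [|q r|m _]; [by rewrite -mpolyC0 | exact: PD |].
rewrite -mul_mpolyC; apply: (PM _ _ (PC _)).
rewrite mpolyXE_id; elim/big_ind: _ => [|q r|i _]; [by rewrite -mpolyC1 | exact: PM |].
elim: (m i) => [|k IHk]; first by rewrite expr0 -mpolyC1.
by rewrite exprS; apply: PM.
Qed.

Lemma mderiv_U (i j : 'I_n) : ('X_i : {mpoly C[n]})^`M(j) = ((i == j)%:R)%:MP.
Proof.
rewrite mderivX mnm1E; case: eqP => [->|_]; last by rewrite scale0r mpolyC0.
by rewrite scale1r -[X in (X - _)%MM]add0m addmK mpolyX0 mpolyC1.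
Qed.

Lemma mderiv0_const p : (forall i, p^`M(i) = 0) -> p = (p@_0%MM)%:MP.
Proof.
move=> p0; apply/mpolyP => m; rewrite mcoeffC eq_sym.
case: eqP => [<-|/eqP nm]; first by rewrite mulr1.
rewrite mulr0; have [i mi] : exists i, m i != 0%N.
  apply/existsP; apply: contra_neqT nm; rewrite negb_exists => /forallP h.
  by apply/mnmP=> i; rewrite mnm0E; have := h i; rewrite negbK => /eqP->.
have := congr1 (fun q => q@_(m - U_(i))%MM) (p0 i).
rewrite mcoeff_deriv mcoeff0 submK ?lep1mP // => /eqP.
by rewrite mulrn_eq0 /= => /eqP.
Qed.

Lemma msize_mderiv p i : p != 0 -> (msize p^`M(i) < msize p)%N.
Proof.
move=> p0; have [->|q0] := eqVneq (p^`M(i)) 0.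
  by rewrite msize0 lt0n msize_poly_eq0.
rewrite -mlead_deg //; have := mlead_supp q0; rewrite mcoeff_msupp mcoeff_deriv.
set m := mlead _ => h; have : (m + U_(i))%MM \in msupp p.
  by rewrite mcoeff_msupp; apply: contraNneq h => ->; rewrite mul0rn.
by move/msize_mdeg_lt; rewrite mdegD mdeg1 addn1.
Qed.

End MpolyBasics.

Definition ext (S : Type) m (g : 'I_m -> S) (h : S) (i : 'I_m.+1) : S :=
  if unlift ord_max i is Some j then g j else h.

Lemma ext_max S m (g : 'I_m -> S) h : ext g h ord_max = h.
Proof. by rewrite /ext unlift_none. Qed.

Lemma ext_lift S m (g : 'I_m -> S) h j : ext g h (lift ord_max j) = g j.
Proof. by rewrite /ext liftK. Qed.

Section Muni.
Variables (C : numFieldType) (n : nat).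

Lemma muniX_max : muni ('X_ord_max : {mpoly C[n.+1]}) = 'X.
Proof.
rewrite /muni mmapX mmap1U; case: splitP => // j /= h.
by have := ltn_ord j; rewrite -h ltnn.
Qed.

Lemma muniX_lift (j : 'I_n) : muni ('X_(lift ord_max j) : {mpoly C[n.+1]}) = ('X_j)%:P.
Proof.
rewrite /muni mmapX mmap1U; case: splitP => k /=; rewrite /bump leqNgt ltn_ord add0n.
  by move=> h; congr ('X__)%:P; apply/val_inj.
by move=> h; have := ltn_ord j; rewrite h ltnNge leq_addr.
Qed.

Lemma mmap_ext (S : comNzRingType) (f : {rmorphism C -> S}) (g : 'I_n -> S) h G :
  mmap f (ext g h) G = (map_poly (mmap f g) (muni G)).[h].
Proof.
elim/mpoly_ring_ind: G => [a|i|q r Hq Hr|q r Hq Hr].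
- by rewrite muniC map_polyC hornerC /= !mmapC.
- rewrite mmapX mmap1U; case: (unliftP ord_max i) => [j|] ->.
    by rewrite ext_lift muniX_lift map_polyC hornerC /= mmapX mmap1U.
  by rewrite ext_max muniX_max map_polyX hornerX.
- by rewrite mmapD Hq Hr muniD rmorphD hornerD.
- by rewrite [LHS]rmorphM /= Hq Hr muniM rmorphM hornerM.
Qed.

Lemma muni_eq0 (G : {mpoly C[n.+1]}) : (muni G == 0) = (G == 0).
Proof.
apply/eqP/eqP => [G0|->]; last by rewrite muni0.
suff <- : mmap (@mpolyC n.+1 C) (ext (fun i => 'X_(lift ord_max i)) 'X_ord_max) G = G.
  by rewrite mmap_ext G0 rmorph0 horner0.
elim/mpoly_ring_ind: G {G0} => [a|i|q r Hq Hr|q r Hq Hr].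
- by rewrite mmapC.
- rewrite mmapX mmap1U; case: (unliftP ord_max i) => [j|] ->.
    by rewrite ext_lift.
  by rewrite ext_max.
- by rewrite mmapD Hq Hr.
- by rewrite [LHS]rmorphM /= Hq Hr.
Qed.

End Muni.

Lemma poly_nonroot (C : numFieldType) (p : {poly C}) : p != 0 -> exists c, p.[c] != 0.
Proof.
move=> p0; have := @max_poly_roots _ p [seq i%:R | i <- iota 0 (size p)] p0.
rewrite size_map size_iota ltnn map_inj_uniq ?iota_uniq; last first.
  by move=> i j /eqP; rewrite eqr_nat => /eqP.
case: allP => [_ /(_ isT isT)//|h _].
have /existsPNP[c _ hc] : ~ forall c, c \in [seq i%:R | i <- iota 0 (size p)] -> root p c by exact: h.
by exists c; apply/negP.
Qed.

Lemma meval_nz (C : numFieldType) n (p : {mpoly C[n]}) :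
  p != 0 -> exists u : 'I_n -> C, p.@[u] != 0.
Proof.
elim: n p => [|n IHn] p p0.
  exists (fun=> 0); rewrite (nvar0_mpolyC p) mevalC; apply: contraNneq p0 => h.
  by rewrite (nvar0_mpolyC p) h mpolyC0.
have [v hv] : exists v : 'I_n -> C, (lead_coef (muni p)).@[v] != 0.
  by apply: IHn; rewrite lead_coef_eq0 muni_eq0.
have [c hc] : exists c, (map_poly (meval v) (muni p)).[c] != 0.
  apply: poly_nonroot; apply: contraNneq hv => h.
  by rewrite /lead_coef -(coef_map (meval v)) h coef0.
by exists (ext v c); rewrite /meval mmap_ext.
Qed.

Lemma deriv_mpoly_neq0 (C : numFieldType) n (p : {poly {mpoly C[n]}}) :
  (1 < size p)%N -> p^`() != 0.
Proof.
case E : (size p) => [|[|s]] // _; apply/eqP => /polyP/(_ s).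
rewrite coef_deriv coef0 => /eqP; rewrite -mulr_natr mulf_eq0.
rewrite -(rmorph_nat (@mpolyC n C)) mpolyC_eq0 pnatr_eq0 orbF.
have := lead_coef_eq0 p; rewrite lead_coefE E /= => ->.
by rewrite -size_poly_eq0 E.
Qed.

(** * Algebraic independence and Jacobians in a differential field *)

Section Derivation.
Variables (C : numFieldType) (S : comNzRingType) (io : {rmorphism C -> S}).
Variable d : S -> S.
Hypothesis dD : forall x y, d (x + y) = d x + d y.
Hypothesis dM : forall x y, d (x * y) = d x * y + x * d y.
Hypothesis dC : forall c, d (io c) = 0.

Lemma derivation0 : d 0 = 0.
Proof. by have := dC 0; rewrite rmorph0. Qed.

Lemma chain_rule m (g : 'I_m -> S) G :
  d (mmap io g G) = \sum_i mmap io g (G^`M(i)) * d (g i).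
Proof.
elim/mpoly_ring_ind: G => [a|i|p q Hp Hq|p q Hp Hq].
- by rewrite mmapC dC big1 // => i _; rewrite mderivC mmap0 mul0r.
- rewrite mmapX mmap1U (bigD1 i) //= mderiv_U eqxx mmapC /= rmorph1 mul1r.
  rewrite big1 ?addr0 // => l nl; rewrite mderiv_U mmapC eq_sym (negbTE nl) /=.
  by rewrite rmorph0 mul0r.
- rewrite mmapD dD Hp Hq -big_split /=; apply: eq_bigr => i _.
  by rewrite mderivD mmapD mulrDl.
- rewrite [mmap _ _ (p * q)]rmorphM /= dM Hp Hq mulr_suml mulr_sumr -big_split /=.
  apply: eq_bigr => i _.
  rewrite mderivM [mmap _ _ (_ + _)]mmapD.
  rewrite [mmap _ _ (_ * q)]rmorphM [mmap _ _ (p * _)]rmorphM /=; ring.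
Qed.

Lemma chain_rule_horner m (g : 'I_m -> S) (H : {poly {mpoly C[m]}}) h :
  d (map_poly (mmap io g) H).[h] =
  \sum_i (map_poly (mmap io g) (map_poly (mderiv i) H)).[h] * d (g i)
  + (map_poly (mmap io g) H^`()).[h] * d h.
Proof.
elim/poly_ind: H => [|H c IH].
  rewrite !rmorph0 horner0 derivation0 deriv0 rmorph0 horner0 mul0r addr0 big1 // => i _.
  by rewrite raddf0 rmorph0 horner0 mul0r.
have E i : map_poly (mderiv i) (H * 'X + c%:P) = map_poly (mderiv i) H * 'X + (c^`M(i))%:P.
  apply/polyP => l; rewrite coefD coefMX coefC [LHS]coef_map coefD coefMX coefC /= mderivD.
  by case: l => [|l] /=; rewrite ?mderiv0 // coef_map.
rewrite derivD derivM derivX derivC addr0 mulr1.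
rewrite !rmorphD !rmorphM /= !map_polyX !map_polyC !hornerE /= dD dM IH chain_rule.
under [X in _ = X + _]eq_bigr => i _ do
  rewrite E rmorphD rmorphM /= map_polyX map_polyC !hornerE mulrDl.
rewrite big_split /=.
rewrite !mulrDl mulr_suml.
under [X in _ = X + _ + _]eq_bigr => i _ do rewrite -mulrA [h * _]mulrC mulrA.
rewrite -!addrA; congr (_ + _); ring.
Qed.

End Derivation.

Section DiffField.
Variables (C : numFieldType) (K : fieldType) (io : {rmorphism C -> K}) (k : nat).
Variables (D : 'I_k -> K -> K) (u : 'I_k -> K).

Definition aindep m (g : 'I_m -> K) :=
  forall G : {mpoly C[m]}, mmap io g G = 0 -> G = 0.

Definition jac m (g : 'I_m -> K) : 'M[K]_(m, k) := \matrix_(i, j) D j (g i).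

Hypothesis DD : forall j x y, D j (x + y) = D j x + D j y.
Hypothesis DM : forall j x y, D j (x * y) = D j x * y + x * D j y.
Hypothesis DC : forall j c, D j (io c) = 0.

Let D0 j : D j 0 = 0 := derivation0 (DC j).
Let chain m (g : 'I_m -> K) G j := chain_rule (DD j) (DM j) (DC j) g G.
Let chain_horner m (g : 'I_m -> K) H h j := chain_rule_horner (DD j) (DM j) (DC j) g H h.

Lemma jac_free_aindep m (g : 'I_m -> K) : row_free (jac g) -> aindep g.
Proof.
move=> fr G; have [s] := ubnP (msize G); elim: s G => // s IH G ltG G0.
have [->//|nz] := eqVneq G 0.
suff dG i : G^`M(i) = 0.
  move: G0; rewrite (mderiv0_const dG) mmapC => /eqP; rewrite fmorph_eq0 => /eqP->.
  by rewrite mpolyC0.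
apply: IH; first exact: leq_trans (msize_mderiv i nz) ltG.
pose v := \row_i mmap io g (G^`M(i)).
suff /rowP/(_ i) : v = 0 by rewrite !mxE.
apply: (row_free_inj fr); rewrite mul0mx; apply/rowP => j; rewrite !mxE.
under eq_bigr do rewrite !mxE.
by rewrite -chain G0 D0.
Qed.

Lemma alg_minpoly m (g : 'I_m -> K) h : aindep g -> ~ aindep (ext g h) ->
  exists H : {poly {mpoly C[m]}}, (map_poly (mmap io g) H).[h] = 0 /\
    (map_poly (mmap io g) H^`()).[h] != 0.
Proof.
move=> ig /existsNP[G /not_implyP[G0 /eqP Gn]].
rewrite mmap_ext in G0; move: G0; rewrite -muni_eq0 in Gn.
move: (muni G) Gn => H.
have [s] := ubnP (size H); elim: s H => // s IH H ltH Hn H0.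
have [d0|] := eqVneq (map_poly (mmap io g) H^`()).[h] 0; last by exists H.
have [dH|dn] := eqVneq (H^`()) 0; last first.
  by apply: IH d0 => //; apply: leq_trans (lt_size_deriv Hn) ltH.
have sH : (size H <= 1)%N.
  by rewrite leqNgt; apply/negP => /deriv_mpoly_neq0; rewrite dH eqxx.
move: H0 Hn; rewrite (size1_polyC sH) map_polyC hornerC /= => /ig ->.
by rewrite eqxx.
Qed.

Hypothesis Du : forall i j, D j (u i) = (i == j)%:R.
Hypothesis alg_dep : forall m (g : 'I_m -> K), (k < m)%N -> ~ aindep g.

(* Add variables u_i to g as long as it stays independent; once all of them are
   algebraic over g, differentiating minimal relations puts every d u_i in the
   span of the d g_i, and there are at most k of the latter. *)
Lemma aindep_jac_free m (g : 'I_m -> K) : aindep g -> row_free (jac g).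
Proof.
have [|lt] := leqP m k; last by move=> /(alg_dep lt).
move=> le; rewrite -ltnS in le; move: le.
have [d] := ubnP (k.+1 - m); elim: d m g => // d IH m g ltd le ig.
have [[i ii]|no] := pselect (exists i, aindep (ext g (u i))).
  have [|lt] := leqP m.+1 k; last by have := alg_dep lt ii.
  move=> lek; have : row_free (jac (ext g (u i))).
    by apply: IH ii; rewrite ?ltnS //; move: ltd; rewrite subSn // ltnS.
  case/row_freeP => B BE; apply/row_freeP; exists (colsub (lift ord_max) B).
  have -> : jac g = rowsub (lift ord_max) (jac (ext g (u i))).
    by apply/matrixP => a b; rewrite !mxE ext_lift.
  rewrite -mxsub_mul BE; apply/matrixP => a b; rewrite !mxE.
  by rewrite (inj_eq lift_inj).
have full : row_full (jac g).
  rewrite -sub1mx; apply/row_subP => i.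
  have [H [H0 H1]] := alg_minpoly ig (fun a => no (ex_intro _ i a)).
  pose v := \row_l ((map_poly (mmap io g) (map_poly (mderiv l) H)).[u i]).
  suff -> : row i 1%:M = (- (map_poly (mmap io g) H^`()).[u i]^-1) *: (v *m jac g).
    by rewrite scalemx_sub // submxMl.
  apply/rowP => j; have := chain_horner g H (u i) j.
  rewrite H0 D0 Du !mxE => /esym/eqP; rewrite addr_eq0 => /eqP E.
  under [X in _ = _ * X]eq_bigr do rewrite !mxE.
  by rewrite E mulrNN mulrA mulVf ?mul1r.
have := full; rewrite /row_full => /eqP rk.
rewrite /row_free eqn_leq rank_leq_row /= rk; by rewrite -ltnS.
Qed.

(* phi \o I is a transcendence basis and H j a separable equation of phi j. *)
Lemma tangent_relations N (phi : 'I_N -> K) :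
  exists (I : 'I_(\rank (jac phi)) -> 'I_N)
    (H : 'I_N -> {poly {mpoly C[\rank (jac phi)]}}),
  row_free (jac (phi \o I)) /\
  forall j, (map_poly (mmap io (phi \o I)) (H j)).[phi j] = 0 /\
            (map_poly (mmap io (phi \o I)) (H j)^`()).[phi j] != 0.
Proof.
pose I := maxrankfun (jac phi); exists I.
have jE : jac (phi \o I) = rowsub I (jac phi) by apply/matrixP => a b; rewrite !mxE.
have fr : row_free (jac (phi \o I)) by rewrite jE maxrowsub_free.
have rel j : exists H : {poly {mpoly C[\rank (jac phi)]}},
    (map_poly (mmap io (phi \o I)) H).[phi j] = 0 /\
    (map_poly (mmap io (phi \o I)) H^`()).[phi j] != 0.
  apply: alg_minpoly; first exact: jac_free_aindep.
  move/aindep_jac_free; rewrite /row_free => /eqP rk.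
  suff : (\rank (jac (ext (phi \o I) (phi j))) <= \rank (jac phi))%N by rewrite rk ltnn.
  apply: mxrankS; apply/row_subP => i.
  suff [l ->] : exists l, row i (jac (ext (phi \o I) (phi j))) = row l (jac phi).
    exact: row_sub.
  case: (unliftP ord_max i) => [l|] ->.
    by exists (I l); apply/rowP => b; rewrite !mxE ext_lift.
  by exists j; apply/rowP => b; rewrite !mxE ext_max.
by have [H HP] := choice rel; exists H.
Qed.

End DiffField.

(** * The field of rational functions *)

Section Generic.
Variables (C : numFieldType) (n : nat).
Implicit Types P Q : ('I_n -> C) -> Prop.

(* Convertible to [general] when [C] is [R[i]]. *)
Definition generic P := exists g : {mpoly C[n]}, g != 0 /\ forall u, g.@[u] != 0 -> P u.

Lemma generic_imp P Q : (forall u, P u -> Q u) -> generic P -> generic Q.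
Proof. by move=> h [g [g0 gP]]; exists g; split => // u /gP/h. Qed.

Lemma genericI P Q : generic P -> generic Q -> generic (fun u => P u /\ Q u).
Proof.
move=> [g [g0 gP]] [h [h0 hQ]]; exists (g * h); rewrite mulf_neq0 //; split=> // u.
by rewrite mevalM mulf_eq0 negb_or => /andP[/gP ? /hQ].
Qed.

Lemma generic_ex P : generic P -> exists u, P u.
Proof. by move=> [g [/meval_nz[u gu] gP]]; exists u; apply: gP. Qed.

Lemma genericT P : (forall u, P u) -> generic P.
Proof. by move=> h; exists 1; rewrite oner_neq0; split. Qed.

Lemma generic_nz (p : {mpoly C[n]}) : p != 0 -> generic (fun u => p.@[u] != 0).
Proof. by move=> p0; exists p. Qed.

Lemma generic_seq (I : eqType) (s : seq I) (P : I -> ('I_n -> C) -> Prop) :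
  (forall i, i \in s -> generic (P i)) -> generic (fun u => forall i, i \in s -> P i u).
Proof.
elim: s => [|a s IH] h; first by apply: genericT.
have ga : generic (P a) by apply: h; rewrite mem_head.
have gs : generic (fun u => forall i, i \in s -> P i u).
  by apply: IH => i si; apply: h; rewrite inE si orbT.
apply: generic_imp (genericI ga gs) => u [Pa Ps] i.
by rewrite inE => /orP[/eqP->|/Ps].
Qed.

Lemma generic_fin (I : finType) (P : I -> ('I_n -> C) -> Prop) :
  (forall i, generic (P i)) -> generic (fun u => forall i, P i u).
Proof.
move=> h; have [i _|g [g0 gP]] := @generic_seq I (enum I) P; first exact: h.
by exists g; split => // u /gP Pu i; apply: Pu; rewrite mem_enum.
Qed.

End Generic.

Section FractionRepresentative.
Import FracField.

Lemma fraction_ex (R : idomainType) (x : {fraction R}) :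
  exists p : R * R, p.2 != 0 /\ x = p.1%:F / p.2%:F.
Proof.
elim/quotW: x => r; exists (frac r); split; first exact: denom_ratioP.
have d0 : \d_r != 0 by exact: denom_ratioP.
rewrite -[RHS]/(FracField.mul (tofrac \n_r) (FracField.inv (tofrac \d_r))) !piE.
apply/eqP; rewrite piE /= equivfE /mulf /invf !numden_Ratio ?oner_neq0 ?mulr1 ?mul1r //.
by rewrite mulrC.
Qed.

End FractionRepresentative.

Lemma quotient_rule (K : fieldType) (a b n d a' b' n' d' : K) : b != 0 -> d != 0 ->
  a * d = n * b -> a' * d + a * d' = n' * b + n * b' ->
  (n' * d - n * d') / d ^+ 2 = (a' * b - a * b') / b ^+ 2.
Proof.
move=> b0 d0 e e'.
have -> : n = a * d / b by rewrite e mulfK.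
have -> : n' = (a' * d + a * d' - n * b') / b by rewrite e' addrK mulfK.
have -> : n = a * d / b by rewrite e mulfK.
by field; rewrite b0 d0.
Qed.

Lemma quotient_ruleD (K : fieldType) (a b c d a' b' c' d' : K) : b != 0 -> d != 0 ->
  ((a' * d + a * d' + (c' * b + c * b')) * (b * d) -
   (a * d + c * b) * (b' * d + b * d')) / (b * d) ^+ 2 =
  (a' * b - a * b') / b ^+ 2 + (c' * d - c * d') / d ^+ 2.
Proof. by move=> b0 d0; field; rewrite b0 d0. Qed.

Lemma quotient_ruleM (K : fieldType) (a b c d a' b' c' d' : K) : b != 0 -> d != 0 ->
  ((a' * c + a * c') * (b * d) - (a * c) * (b' * d + b * d')) / (b * d) ^+ 2 =
  (a' * b - a * b') / b ^+ 2 * (c / d) + a / b * ((c' * d - c * d') / d ^+ 2).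
Proof. by move=> b0 d0; field; rewrite b0 d0. Qed.

Lemma cancel_commutator (K : fieldType) (x y b p q r : K) : b != 0 ->
  x * b + p + (q + r) = y * b + q + (p + r) -> x = y.
Proof.
move=> b0 e; apply: (mulIf b0); apply: (addIr (p + q + r)).
rewrite -[in LHS](addrA p) [LHS]addrA e -!addrA; congr (_ + _).
by rewrite addrCA.
Qed.

Section FractionField.
Variables (C : numFieldType) (k : nat).
Local Notation P := {mpoly C[k]}.
Local Notation K := {fraction P}.
Implicit Types (x y : K) (a b p q : P).

Definition numf x : P := (projT1 (cid (fraction_ex x))).1.
Definition denf x : P := (projT1 (cid (fraction_ex x))).2.

Lemma denf_neq0 x : denf x != 0.
Proof. by rewrite /denf; case: cid => -[a b] []. Qed.

Lemma numden x : x = (numf x)%:F / (denf x)%:F.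
Proof. by rewrite /numf /denf; case: cid => -[a b] []. Qed.

Lemma tofrac_neq0 a : a != 0 -> a%:F != 0.
Proof. by rewrite tofrac_eq0. Qed.

Lemma fracE_eq a b c d : b != 0 -> d != 0 -> (a%:F / b%:F == c%:F / d%:F) = (a * d == c * b).
Proof.
move=> b0 d0; rewrite -[RHS]tofrac_eq !tofracM.
by rewrite eqr_div ?tofrac_neq0.
Qed.

Definition fD (j : 'I_k) x : K :=
  ((numf x)^`M(j)%:F * (denf x)%:F - (numf x)%:F * (denf x)^`M(j)%:F) / (denf x)%:F ^+ 2.

Lemma fD_frac j a b : b != 0 ->
  fD j (a%:F / b%:F) = (a^`M(j)%:F * b%:F - a%:F * b^`M(j)%:F) / b%:F ^+ 2.
Proof.
move=> b0; rewrite /fD.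
have := numden (a%:F / b%:F); move: (numf _) (denf _) (denf_neq0 (a%:F / b%:F)) => n d d0.
move/eqP; rewrite fracE_eq // => /eqP e.
apply: quotient_rule; rewrite ?tofrac_neq0 //.
  by rewrite -!tofracM e.
by rewrite -!tofracM -!tofracD -!mderivM e.
Qed.

Lemma fD_poly j a : fD j a%:F = a^`M(j)%:F.
Proof.
have := fD_frac j a (oner_neq0 P).
by rewrite tofrac1 !divr1 expr1n !divr1 mulr1 mderivC tofrac0 mulr0 subr0.
Qed.

Lemma fDD j x y : fD j (x + y) = fD j x + fD j y.
Proof.
have bx := denf_neq0 x; have bY := denf_neq0 y; rewrite (numden x) (numden y).
move: (numf x) (numf y) (denf x) (denf y) bx bY => a c b d b0 d0.
rewrite addf_div ?tofrac_neq0 // -!tofracM -tofracD !fD_frac ?mulf_neq0 //.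
by rewrite mderivD !mderivM !(tofracD, tofracM) quotient_ruleD ?tofrac_neq0.
Qed.

Lemma fDM j x y : fD j (x * y) = fD j x * y + x * fD j y.
Proof.
have bx := denf_neq0 x; have bY := denf_neq0 y; rewrite (numden x) (numden y).
move: (numf x) (numf y) (denf x) (denf y) bx bY => a c b d b0 d0.
rewrite mulf_div -!tofracM !fD_frac ?mulf_neq0 //.
by rewrite !mderivM !(tofracD, tofracM) quotient_ruleM ?tofrac_neq0.
Qed.

Definition cst : {rmorphism C -> K} := (@FracField.tofrac P \o @mpolyC k C)%FUN.

Lemma cstE c : cst c = (c%:MP)%:F. Proof. by []. Qed.

Lemma fDC j c : fD j (cst c) = 0.
Proof. by rewrite cstE fD_poly mderivC tofrac0. Qed.

Definition fX (i : 'I_k) : K := ('X_i : P)%:F.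

Lemma fDX i j : fD j (fX i) = (i == j)%:R.
Proof. by rewrite fD_poly mderiv_U mpolyC_nat rmorph_nat. Qed.

Lemma fD_comm i j x : fD i (fD j x) = fD j (fD i x).
Proof.
have b0 := denf_neq0 x; set b := denf x in b0.
have xb : x * b%:F = (numf x)%:F by rewrite {1}(numden x) divfK ?tofrac_neq0.
have : fD i (fD j (x * b%:F)) = fD j (fD i (x * b%:F)) by rewrite xb !fD_poly mderiv_comm.
rewrite !(fDM, fDD, fD_poly) (mderiv_comm i j b).
exact: (cancel_commutator (tofrac_neq0 b0)).
Qed.

Lemma msizeM_deg d e p q :
  (msize p <= d.+1)%N -> (msize q <= e.+1)%N -> (msize (p * q) <= (d + e).+1)%N.
Proof.
move=> hp hq; have [->|p0] := eqVneq p 0; first by rewrite mul0r msize0.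
have [->|q0] := eqVneq q 0; first by rewrite mulr0 msize0.
rewrite msizeM //; move: p0 q0 hp hq; rewrite -!(msize_poly_eq0) -!lt0n.
by case: (msize p) (msize q) => [|s] [|t] //= _ _; rewrite !ltnS addnS => *; apply: leq_add.
Qed.

Lemma msizeX_deg d p N : (msize p <= d.+1)%N -> (msize (p ^+ N) <= (N * d).+1)%N.
Proof.
move=> hp; elim: N => [|N IH]; first by rewrite expr0 mul0n msize1.
by rewrite exprS mulSn; apply: msizeM_deg.
Qed.

Lemma msize_prod_deg (I : finType) (d : nat) (p : I -> P) :
  (forall i, msize (p i) <= d.+1)%N -> (msize (\prod_i p i) <= (#|I| * d).+1)%N.
Proof.
move=> hp; have -> : (#|I| * d)%N = (\sum_(i : I) d)%N by rewrite sum_nat_const.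
elim/big_ind2: _ => [|q d1 r d2|i _]; [by rewrite msize1|exact: msizeM_deg|exact: hp].
Qed.

Lemma card_bmnm B : (#|{: 'X_{1..k < B}}| <= B ^ k)%N.
Proof.
rewrite -[X in (_ <= X ^ _)%N]card_ord -[X in (_ <= _ ^ X)%N]card_ord -card_ffun.
have lt (m : 'X_{1..k < B}) i : (bmnm m i < B)%N.
  by apply: leq_ltn_trans (bmdeg m); rewrite mdegE (bigD1 i) //= leq_addr.
pose f (m : 'X_{1..k < B}) := [ffun i => Ordinal (lt m i)].
apply: (@leq_card _ _ f) => m1 m2 /ffunP e; apply/val_inj/mnmP => i.
by have := e i; rewrite !ffunE => /(congr1 val).
Qed.

Lemma common_denominator m (g : 'I_m -> K) :
  exists (a : 'I_m -> P) (b : P), b != 0 /\ forall i, g i = (a i)%:F / b%:F.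
Proof.
pose b := \prod_i denf (g i).
have b0 : b != 0 by apply/prodf_neq0 => i _; apply: denf_neq0.
exists (fun i => numf (g i) * \prod_(j | j != i) denf (g j)), b; split=> // i.
rewrite {1}(numden (g i)); apply/eqP; rewrite fracE_eq ?denf_neq0 //.
by rewrite /b (bigD1 i) //= mulrCA mulrC.
Qed.

(* Dimension count: multiplied by a power of a common denominator, the N ^ m
   monomials in g with exponents below N lie in a space of polynomials whose
   dimension grows like N ^ k. *)
Lemma alg_dep m (g : 'I_m -> K) : (k < m)%N -> ~ aindep cst g.
Proof.
move=> ltkm ig; have [a [b [b0 gE]]] := common_denominator g.
pose e := (\sum_i msize (a i) + msize b)%N.
have ha i : (msize (a i) <= e.+1)%N.
  by apply: leqW; rewrite /e (bigD1 i) //= -addnA leq_addr.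
have hb : (msize b <= e.+1)%N by apply: leqW; rewrite /e leq_addl.
pose c := (m * (e + e)).+2; pose N := (c ^ k).+1.
pose B := (m * (N * e + N * e)).+2.
pose T (mu : {ffun 'I_m -> 'I_N}) := \prod_i (a i ^+ mu i * b ^+ (N - mu i)).
have sT mu : (msize (T mu) < B)%N.
  rewrite ltnS -[m]card_ord; apply: msize_prod_deg => i; apply: msizeM_deg.
    apply: leq_trans (msizeX_deg (mu i) (ha i)) _.
    by rewrite ltnS leq_mul2r ltnW ?orbT.
  apply: leq_trans (msizeX_deg _ hb) _.
  by rewrite ltnS leq_mul2r leq_subr orbT.
have ltBN : (B ^ k < N ^ m)%N.
  apply: leq_trans (_ : N ^ k.+1 <= _)%N; last by rewrite leq_pexp2l.
  have leB : (B <= c * N)%N.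
    rewrite /B /c -mulnDr mulnCA -(addn2 (m * _)) mulnDl mulnC -addn2 leq_add2l.
    by rewrite -[X in (X <= _)%N]muln1 leq_mul2l.
  have leX l : (B ^ l <= (c * N) ^ l)%N by elim: l => // l IH; rewrite !expnS leq_mul.
  apply: leq_ltn_trans (leX k) _.
  by rewrite expnMn expnS ltn_mul2r expn_gt0 /= ltnS leqnn.
pose M : 'M[C]_(#|{ffun 'I_m -> 'I_N}|, #|{: 'X_{1..k < B}}|) :=
  \matrix_(i, j) (T (enum_val i))@_(bmnm (enum_val j : 'X_{1..k < B})).
have ker : kermx M != 0.
  rewrite kermx_eq0 /row_free neq_ltn; apply/orP; left.
  apply: leq_ltn_trans (rank_leq_col M) _; apply: leq_ltn_trans (card_bmnm B) _.
  by rewrite card_ffun !card_ord.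
have /rowV0Pn[v /sub_kermxP vM v0] := ker.
pose mon (mu : {ffun 'I_m -> 'I_N}) : 'X_{1..m} := [multinom val (mu i) | i < m].
have mon_inj : injective mon.
  by move=> x y /mnmP e'; apply/ffunP => i; apply/val_inj; have := e' i; rewrite !mnmE.
pose G : {mpoly C[m]} := \sum_i v 0 i *: 'X_[mon (enum_val i)].
have G0 : G = 0.
  apply: ig; have nb : b%:F ^+ (m * N) != 0 by rewrite expf_neq0 ?tofrac_neq0.
  apply: (mulIf nb); rewrite mul0r raddf_sum mulr_suml /=.
  under eq_bigr => i _.
    rewrite mmapZ mmapX /mmap1.
    have -> : \prod_(l < m) g l ^+ mon (enum_val i) l = (T (enum_val i))%:F / b%:F ^+ (m * N).
      rewrite rmorph_prod /= mulnC exprM -[m in _ ^+ m]card_ord -prodr_const -prodf_div.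
      apply: eq_bigr => l _; rewrite mnmE gE rmorphM !rmorphXn /= expr_div_n.
      set t := (enum_val i) l; have tN : (t <= N)%N by rewrite ltnW.
      by rewrite -[in b%:F ^+ N](subnK tN) exprD invfM [RHS]mulrA mulfK
        ?expf_neq0 ?tofrac_neq0.
    rewrite mulrA divfK // cstE -tofracM mul_mpolyC.
    over.
  rewrite -raddf_sum /=; apply/eqP; rewrite tofrac_eq0; apply/eqP/mpolyP => mm.
  rewrite raddf_sum mcoeff0 /=; have [ltm|gem] := ltnP (mdeg mm) B; last first.
    rewrite big1 // => i _; rewrite mcoeffZ memN_msupp_eq0 ?mulr0 //.
    by apply: msize_mdeg_ge; apply: leq_trans gem; apply: ltnW.
  have /rowP/(_ (enum_rank (BMultinom ltm))) := vM; rewrite !mxE => vj.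
  rewrite -[RHS]vj; apply: eq_bigr => i _.
  by rewrite mcoeffZ !mxE enum_rankK.
suff : v = 0 by apply/eqP.
apply/rowP => i; rewrite mxE; have := congr1 (mcoeff (mon (enum_val i))) G0.
rewrite raddf_sum mcoeff0 (bigD1 i) //= mcoeffZ mcoeffX eqxx mulr1 big1 ?addr0 //.
move=> j nj; rewrite mcoeffZ mcoeffX (inj_eq mon_inj) (inj_eq enum_val_inj).
by rewrite (negbTE nj) mulr0.
Qed.

End FractionField.

(** * Values of rational functions at points *)

Section Evals.
Variables (C : numFieldType) (k : nat).
Local Notation P := {mpoly C[k]}.
Local Notation K := {fraction P}.
Implicit Types (x y : K) (a b p q : P) (u : 'I_k -> C) (v w : C).

(* A relation and not a function: x has a value at u as soon as one of its
   representatives a / b satisfies b(u) != 0. *)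
Definition evals u x v :=
  exists a b, [/\ b.@[u] != 0, x = a%:F / b%:F & v = a.@[u] / b.@[u]].

Lemma meval_neq0 u p : p.@[u] != 0 -> p != 0.
Proof. by apply: contraNneq => ->; rewrite meval0. Qed.

Lemma evals_uniq u x v w : evals u x v -> evals u x w -> v = w.
Proof.
move=> [a [b [b0 -> ->]]] [c [d [d0 /eqP e ->]]]; apply/eqP.
rewrite fracE_eq ?(meval_neq0 b0) ?(meval_neq0 d0) // in e.
by rewrite eqr_div // -!mevalM (eqP e).
Qed.

Lemma evals_frac u a b : b.@[u] != 0 -> evals u (a%:F / b%:F) (a.@[u] / b.@[u]).
Proof. by move=> b0; exists a, b. Qed.

Lemma evals_poly u p : evals u p%:F p.@[u].
Proof. by exists p, 1; rewrite meval1 oner_neq0 tofrac1 !divr1. Qed.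

Lemma evals_cst u c : evals u (cst C k c) c.
Proof. by have := evals_poly u c%:MP; rewrite mevalC. Qed.

Lemma evals0 u v : evals u 0 v -> v = 0.
Proof. by move=> h; apply: (evals_uniq h); rewrite -(rmorph0 (cst C k)); apply: evals_cst. Qed.

Lemma evalsD u x y v w : evals u x v -> evals u y w -> evals u (x + y) (v + w).
Proof.
move=> [a [b [b0 -> ->]]] [c [d [d0 -> ->]]]; exists (a * d + c * b), (b * d).
rewrite mevalM mulf_neq0 //; split=> //.
  by rewrite addf_div ?tofrac_neq0 ?(meval_neq0 b0) ?(meval_neq0 d0) // tofracD !tofracM.
by rewrite addf_div // mevalD !mevalM.
Qed.

Lemma evalsM u x y v w : evals u x v -> evals u y w -> evals u (x * y) (v * w).
Proof.
move=> [a [b [b0 -> ->]]] [c [d [d0 -> ->]]]; exists (a * c), (b * d).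
rewrite mevalM mulf_neq0 //; split=> //; first by rewrite mulf_div !tofracM.
by rewrite mulf_div mevalM.
Qed.

Lemma evalsN u x v : evals u x v -> evals u (- x) (- v).
Proof.
move=> [a [b [b0 -> ->]]]; exists (- a), b; split=> //.
  by rewrite tofracN mulNr.
by rewrite mevalN mulNr.
Qed.

Lemma evalsB u x y v w : evals u x v -> evals u y w -> evals u (x - y) (v - w).
Proof. by move=> hx hy; apply: evalsD => //; apply: evalsN. Qed.

Lemma evalsV u x v : v != 0 -> evals u x v -> evals u x^-1 v^-1.
Proof.
move=> v0 [a [b [b0 -> e]]]; rewrite e in v0 *; exists b, a; rewrite !invfM !invrK.
split; [|by rewrite mulrC|by rewrite mulrC].
by apply: contraNneq v0 => ->; rewrite mul0r.
Qed.

Lemma evals_sum u (I : Type) (r : seq I) (Q : pred I) (F : I -> K) (G : I -> C) :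
  (forall i, evals u (F i) (G i)) ->
  evals u (\sum_(i <- r | Q i) F i) (\sum_(i <- r | Q i) G i).
Proof.
move=> h; elim/big_ind2: _ => [|x v y w|//]; last exact: evalsD.
by rewrite -(rmorph0 (cst C k)); apply: evals_cst.
Qed.

Lemma evals_prod u (I : Type) (r : seq I) (Q : pred I) (F : I -> K) (G : I -> C) :
  (forall i, evals u (F i) (G i)) ->
  evals u (\prod_(i <- r | Q i) F i) (\prod_(i <- r | Q i) G i).
Proof.
move=> h; elim/big_ind2: _ => [|x v y w|//]; last exact: evalsM.
by rewrite -(rmorph1 (cst C k)); apply: evals_cst.
Qed.

Lemma evals_mmap u m (g : 'I_m -> K) (h : 'I_m -> C) G :
  (forall i, evals u (g i) (h i)) -> evals u (mmap (cst C k) g G) G.@[h].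
Proof.
move=> gh; elim/mpoly_ring_ind: G => [a|i|p q Hp Hq|p q Hp Hq].
- by rewrite mmapC mevalC; apply: evals_cst.
- by rewrite mmapX mmap1U mevalXU.
- by rewrite mmapD mevalD; apply: evalsD.
- by rewrite [mmap _ _ _]rmorphM mevalM; apply: evalsM.
Qed.

Lemma evals_horner u m (g : 'I_m -> K) (h : 'I_m -> C) (H : {poly {mpoly C[m]}}) y w :
  (forall i, evals u (g i) (h i)) -> evals u y w ->
  evals u (map_poly (mmap (cst C k) g) H).[y] (map_poly (meval h) H).[w].
Proof.
move=> gh yw; elim/poly_ind: H => [|H c IH].
  by rewrite !rmorph0 !horner0 -(rmorph0 (cst C k)); apply: evals_cst.
rewrite !rmorphD !rmorphM /= !map_polyX !map_polyC !hornerE.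
by apply: evalsD; [exact: evalsM | exact: evals_mmap].
Qed.

Lemma evals_generic x : generic (fun u => exists v, evals u x v).
Proof.
exists (denf x); split; first exact: denf_neq0.
by move=> u du; exists ((numf x).@[u] / (denf x).@[u]); exists (numf x), (denf x); rewrite -numden.
Qed.

Lemma evals_generic_neq0 x : x != 0 -> generic (fun u => forall v, evals u x v -> v != 0).
Proof.
move=> x0; have n0 : numf x != 0.
  by apply: contraNneq x0 => e; rewrite (numden x) e tofrac0 mul0r.
apply: generic_imp (genericI (generic_nz n0) (generic_nz (denf_neq0 x))) => u [nu du] v ev.
suff -> : v = (numf x).@[u] / (denf x).@[u] by rewrite mulf_neq0 ?invr_eq0.
by apply: evals_uniq ev _; rewrite {1}(numden x); apply: evals_frac.
Qed.

Lemma evals_eq0 x : generic (fun u => forall v, evals u x v -> v = 0) -> x = 0.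
Proof.
move=> g0; apply/eqP; apply: contraT => /evals_generic_neq0 g1.
have [u [[h0 h1] [v ev]]] := generic_ex (genericI (genericI g0 g1) (evals_generic x)).
by have := h1 v ev; rewrite (h0 v ev) eqxx.
Qed.

Definition evalmx u r s (M : 'M[K]_(r, s)) (N : 'M[C]_(r, s)) :=
  forall i j, evals u (M i j) (N i j).

Lemma evalmx_uniq u r s (M : 'M[K]_(r, s)) N N' : evalmx u M N -> evalmx u M N' -> N = N'.
Proof. by move=> h h'; apply/matrixP => i j; apply: evals_uniq (h i j) (h' i j). Qed.

Lemma evalmx_generic r s (M : 'M[K]_(r, s)) : generic (fun u => exists N, evalmx u M N).
Proof.
have := generic_fin (fun i => generic_fin (fun j => evals_generic (M i j))).
apply: generic_imp => u h; exists (\matrix_(i, j) projT1 (cid (h i j))) => i j.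
by rewrite mxE; case: cid.
Qed.

Lemma evalmxM u r s t (M : 'M[K]_(r, s)) (M' : 'M[K]_(s, t)) N N' :
  evalmx u M N -> evalmx u M' N' -> evalmx u (M *m M') (N *m N').
Proof. by move=> h h' i j; rewrite !mxE; apply: evals_sum => l; apply: evalsM. Qed.

Lemma evalmx_cst u r s (N : 'M[C]_(r, s)) : evalmx u (map_mx (cst C k) N) N.
Proof. by move=> i j; rewrite mxE; apply: evals_cst. Qed.

Lemma evalmx_det u r (M : 'M[K]_r) N : evalmx u M N -> evals u (\det M) (\det N).
Proof.
move=> h; apply: evals_sum => s; apply: evalsM; last by apply: evals_prod.
rewrite -(rmorph_sign (cst C k)); exact: evals_cst.
Qed.

Lemma evalmx_row_free u r s (M : 'M[K]_(r, s)) N : evalmx u M N -> row_free N -> row_free M.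
Proof.
move=> h /row_freeP[B NB]; have := evalmx_det (evalmxM h (evalmx_cst u B)).
rewrite NB det1 => d1; apply/row_freeP.
exists (map_mx (cst C k) B *m invmx (M *m map_mx (cst C k) B)); rewrite mulmxA mulmxV //.
rewrite unitmxE unitfE; apply: contraPneq d1 => -> /evals0/eqP.
by rewrite oner_eq0.
Qed.

Lemma evalmx_rank r s (M : 'M[K]_(r, s)) :
  generic (fun u => forall N, evalmx u M N -> \rank N = \rank M).
Proof.
pose L := col_ebase M; pose U := row_ebase M.
have gL := genericI (evalmx_generic L) (evalmx_generic (invmx L)).
have gU := genericI (evalmx_generic U) (evalmx_generic (invmx U)).
apply: generic_imp (genericI gL gU) => u [[[L0 hL] [L1 hL']] [[U0 hU] [U1 hU']]] N hN.
have unit_ev t (X : 'M[K]_t) X0 X1 : X \in unitmx ->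
    evalmx u X X0 -> evalmx u (invmx X) X1 -> X0 \in unitmx.
  move=> uX h0 h1; have e : X0 *m X1 = 1%:M.
    apply: evalmx_uniq (evalmxM h0 h1) _; rewrite mulmxV //.
    by rewrite -(map_mx1 (cst C k)); apply: evalmx_cst.
  by case/mulmx1_unit: e.
have uL : L0 \in unitmx by apply: unit_ev hL hL'; apply: col_ebase_unit.
have uU : U0 \in unitmx by apply: unit_ev hU hU'; apply: row_ebase_unit.
have -> : N = L0 *m pid_mx (\rank M) *m U0.
  apply: evalmx_uniq hN _; rewrite -{1}(mulmx_ebase M).
  apply: evalmxM hU; apply: evalmxM hL _.
  by rewrite -(map_pid_mx (cst C k)); apply: evalmx_cst.
rewrite mxrankMfree ?row_free_unit // -mxrank_tr trmx_mul mxrankMfree; last first.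
  by rewrite row_free_unit unitmx_tr.
by rewrite mxrank_tr rank_pid_mx ?rank_leq_row ?rank_leq_col.
Qed.

End Evals.

(** * Zariski closed sets *)

Section Composition.
Variables (C : numFieldType) (S : comNzRingType) (f : {rmorphism C -> S}) (m n : nat).
Variables (g : 'I_m -> {mpoly C[n]}) (h : 'I_n -> S).

Lemma mmap_comp G :
  mmap f h (mmap (@mpolyC n C) g G) = mmap f (fun i => mmap f h (g i)) G.
Proof.
elim/mpoly_ring_ind: G => [a|i|p q Hp Hq|p q Hp Hq].
- by rewrite !mmapC.
- by rewrite !mmapX !mmap1U.
- by rewrite [in LHS]mmapD [LHS]mmapD Hp Hq mmapD.
- by rewrite [X in mmap f h X]rmorphM [LHS]rmorphM /= Hp Hq [RHS]rmorphM.
Qed.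

Lemma mmap_comp_horner (H : {poly {mpoly C[m]}}) q :
  mmap f h (map_poly (mmap (@mpolyC n C) g) H).[q] =
  (map_poly (mmap f (fun i => mmap f h (g i))) H).[mmap f h q].
Proof.
elim/poly_ind: H => [|H c IH]; first by rewrite !rmorph0 !horner0 mmap0.
rewrite !rmorphD !rmorphM /= !map_polyX !map_polyC !hornerE /=.
by rewrite mmapD [mmap _ _ (_ * _)]rmorphM /= IH mmap_comp.
Qed.

End Composition.

Lemma mmap_id_proj (C : numFieldType) (S : comNzRingType) (f : {rmorphism C -> S}) m n
  (I : 'I_m -> 'I_n) (h : 'I_n -> S) G :
  mmap f h (mmap (@mpolyC n C) (fun i => 'X_(I i)) G) = mmap f (h \o I) G.
Proof.
rewrite mmap_comp; congr (mmap f _ G); apply: funext => i.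
by rewrite mmapX mmap1U.
Qed.

Section Pointsets.
Variables (R : realType) (n : nat).
Local Notation C := R[i].
Local Notation pt := ('I_n -> C).
Implicit Types (Y Z : pt -> Prop) (f g : {mpoly C[n]}).

Lemma sub_zclosure Y : subset Y (zclosure Y).
Proof. by move=> p Yp f; apply. Qed.

Lemma vanishing_zclosure Y f : vanishing (zclosure Y) f <-> vanishing Y f.
Proof.
split=> h p Yp; first by apply: h; apply: sub_zclosure.
exact: Yp.
Qed.

Lemma zclosed_zclosure Y : zclosed (zclosure Y).
Proof. by exists (vanishing Y). Qed.

Lemma zclosureS Y Z : subset Y Z -> subset (zclosure Y) (zclosure Z).
Proof. by move=> YZ p Yp f Zf; apply: Yp => q /YZ; apply: Zf. Qed.

Lemma zclosure_id Y : zclosed Y -> forall p, zclosure Y p <-> Y p.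
Proof.
move=> [S YS] p; split; last exact: sub_zclosure.
by move=> h; apply/YS => f Sf; apply: h => q /YS; apply.
Qed.

Lemma zclosed_vanishing_neq0 Y p : zclosed Y -> ~ Y p ->
  exists f, vanishing Y f /\ f.@[p] != 0.
Proof.
move=> cY Yp; apply: contrapT => no; apply: Yp; apply/(zclosure_id cY) => f Yf.
by apply/eqP; apply: contrapT => /negP f0; apply: no; exists f.
Qed.

Lemma zclosed_zero f : zclosed (fun p => f.@[p] = 0).
Proof.
exists (fun g => g = f) => p; split; last by apply.
by move=> fp g ->.
Qed.

Lemma vanishing_prime Y f g : irreducible_closed Y -> vanishing Y (f * g) ->
  vanishing Y f \/ vanishing Y g.
Proof.
move=> [_ [_ irr]] fg; apply: (irr _ _ (zclosed_zero f) (zclosed_zero g)) => p Yp.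
have /eqP := fg p Yp; rewrite mevalM mulf_eq0 => /orP[/eqP|/eqP]; by [left|right].
Qed.

Lemma vanishing_lincomb Y (I : Type) (r : seq I) (a f : I -> {mpoly C[n]}) :
  (forall i, vanishing Y (f i)) -> vanishing Y (\sum_(i <- r) a i * f i).
Proof.
move=> h p Yp; rewrite raddf_sum big1 //= => i _.
by rewrite mevalM h // mulr0.
Qed.

Lemma has_chainS m Y Z : subset Y Z -> has_chain m Y -> has_chain m Z.
Proof.
move=> YZ [X [X1 X2]]; exists X; split=> // j /X1[? h]; split=> // p /h; exact: YZ.
Qed.

Lemma has_chain_le l m Y : (l <= m)%N -> has_chain m Y -> has_chain l Y.
Proof.
move=> lm [X [X1 X2]]; exists X; split=> j lj; first by apply: X1; apply: leq_trans lm.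
by apply: X2; apply: leq_trans lm.
Qed.

Lemma has_chain_snoc m Y Z : irreducible_closed Z -> subset Y Z ->
  (exists p, Z p /\ ~ Y p) -> has_chain m Y -> has_chain m.+1 Z.
Proof.
move=> irr YZ [p [Zp Yp]] [X [X1 X2]]; exists (fun j => if (j <= m)%N then X j else Z).
split=> j lj.
  case: leqP => // ltm; last by split.
  by have [? h] := X1 j ltm; split=> // q /h/YZ.
rewrite ltnS in lj; rewrite lj; move: lj; rewrite leq_eqVlt => /orP[/eqP->|ltm].
  rewrite ltnn; have [_ h] := X1 m (leqnn m); split=> [q /h/YZ //|].
  by exists p; split=> // /h.
by rewrite ltm; apply: X2.
Qed.

Lemma var_dim_uniq Y d e : var_dim Y d -> var_dim Y e -> d = e.
Proof.
move=> [d1 d2] [e1 e2]; case: (ltngtP d e) => // lt.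
  by case: d2; apply: has_chain_le e1.
by case: e2; apply: has_chain_le d1.
Qed.

Definition rowv (v : pt) : 'rV[C]_n := \row_i v i.

Lemma lin_dim_rowspace (W : pt -> Prop) r (X : 'M[C]_(r, n)) :
  (forall v, W v <-> (rowv v <= X)%MS) -> lin_dim W (\rank X).
Proof.
move=> WX; have rowE s (A : 'M[C]_(s, n)) j : rowv (fun i => A j i) = row j A.
  by apply/rowP => i; rewrite !mxE.
split.
  exists (row_base X); split; first exact/eqP/row_base_free.
  move=> j; apply/WX; rewrite rowE; apply: submx_trans (row_sub _ _) _.
  by rewrite eq_row_base.
move=> [A [rA AW]]; suff /mxrankS : (A <= X)%MS by rewrite rA ltnn.
by apply/row_subP => j; rewrite -rowE; apply/WX.
Qed.

Lemma lin_dim_uniq (W : pt -> Prop) d e : lin_dim W d -> lin_dim W e -> d = e.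
Proof.
suff h a b : has_indep a W -> (b <= a)%N -> has_indep b W.
  move=> [d1 d2] [e1 e2]; case: (ltngtP d e) => // lt.
    by case: d2; apply: h e1 lt.
  by case: e2; apply: h d1 lt.
move=> [A [rA AW]] ba; exists (rowsub (widen_ord ba) A); split; last first.
  by move=> j; have := AW (widen_ord ba j); congr W; apply: funext => i; rewrite mxE.
have /row_freeP[B AB] : row_free A by rewrite /row_free rA.
apply/eqP/row_freeP; exists (colsub (widen_ord ba) B).
rewrite -mxsub_mul AB; apply/matrixP => i j; rewrite !mxE.
by congr (_ %:R); congr nat_of_bool; apply/eqP/eqP => [/(congr1 val)/val_inj|->].
Qed.

End Pointsets.

(** * Closures of images of rational maps *)

Section RationalImage.
Variables (R : realType) (k n : nat).
Local Notation C := R[i].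
Variables (A : 'I_n -> {mpoly C[k]}) (B : {mpoly C[k]}).

Definition rval_at (u : 'I_k -> C) : 'I_n -> C := fun i => (A i).@[u] / B.@[u].
Definition rimage : ('I_n -> C) -> Prop :=
  fun p => exists u, B.@[u] != 0 /\ p = rval_at u.
Definition rfrac (i : 'I_n) : {fraction {mpoly C[k]}} := (A i)%:F / B%:F.
Definition rjac : 'M[{fraction {mpoly C[k]}}]_(n, k) := jac (@fD C k) rfrac.
Definition rjac_at (u : 'I_k -> C) : 'M[C]_(n, k) :=
  \matrix_(i, j) (((A i)^`M(j).@[u] * B.@[u] - (A i).@[u] * B^`M(j).@[u]) / B.@[u] ^+ 2).

Lemma evals_rfrac u : B.@[u] != 0 -> forall i, evals u (rfrac i) (rval_at u i).
Proof. by move=> Bu i; apply: evals_frac. Qed.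

Lemma evals_rjac u : B.@[u] != 0 -> evalmx u rjac (rjac_at u).
Proof.
move=> Bu i j; rewrite !mxE fD_frac ?(meval_neq0 Bu) // expr2 [_ ^+ 2]expr2.
apply: evalsM; last first.
  by apply: evalsV; [rewrite mulf_neq0|apply: evalsM; apply: evals_poly].
by apply: evalsB; apply: evalsM; apply: evals_poly.
Qed.

Hypothesis B0 : B != 0.
Local Notation Y := (zclosure rimage).

Lemma rimage_at u : B.@[u] != 0 -> Y (rval_at u).
Proof. by move=> Bu; apply: sub_zclosure; exists u. Qed.

Lemma vanishing_rimage f : vanishing Y f <-> mmap (cst C k) rfrac f = 0.
Proof.
rewrite vanishing_zclosure; split=> [h|h p [u [Bu ->]]].
  apply: evals_eq0; exists B; split=> // u Bu v ev.
  rewrite (evals_uniq ev (evals_mmap f (evals_rfrac Bu))).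
  by apply: h; exists u.
by have := evals_mmap f (evals_rfrac Bu); rewrite h => /evals0.
Qed.

Lemma irreducible_rimage : irreducible_closed Y.
Proof.
split; first exact: zclosed_zclosure.
split; first by have [u Bu] := meval_nz B0; exists (rval_at u); apply: rimage_at.
move=> Z1 Z2 c1 c2 sub.
have wit Z : zclosed Z -> ~ subset Y Z ->
    exists f, vanishing Z f /\ mmap (cst C k) rfrac f != 0.
  move=> cZ /existsNP[p /not_implyP[Yp Zp]].
  have [f [Zf fp]] := zclosed_vanishing_neq0 cZ Zp; exists f; split=> //.
  by apply: contraNneq fp => /vanishing_rimage/(_ p Yp) ->.
have [|/(wit _ c1)[f [Zf f0]]] := pselect (subset Y Z1); first by left.
have [|/(wit _ c2)[g [Zg g0]]] := pselect (subset Y Z2); first by right.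
have : mmap (cst C k) rfrac (f * g) = 0.
  apply/vanishing_rimage => p /sub[/Zf|/Zg] e; by rewrite mevalM e ?mul0r ?mulr0.
by move/eqP; rewrite [mmap _ _ _]rmorphM /= mulf_eq0 (negbTE f0) (negbTE g0).
Qed.

Lemma rjac_chain m (g : 'I_m -> {mpoly C[n]}) :
  jac (@fD C k) (fun i => mmap (cst C k) rfrac (g i)) =
  (\matrix_(i, j) mmap (cst C k) rfrac ((g i)^`M(j))) *m rjac.
Proof.
apply/matrixP => i j; rewrite !mxE (chain_rule (fDD j) (fDM j) (fDC j)).
by apply: eq_bigr => l _; rewrite !mxE.
Qed.

(* Along a chain of irreducible closed sets one can adjoin, at each step, a
   polynomial vanishing on the smaller set only, and get a family that is
   algebraically independent modulo the ideal of the larger one. *)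
Lemma chain_independent m (Z : nat -> ('I_n -> C) -> Prop) :
  (forall j, (j <= m)%N -> irreducible_closed (Z j)) ->
  (forall j, (j < m)%N -> subset (Z j) (Z j.+1) /\ exists p, Z j.+1 p /\ ~ Z j p) ->
  exists g : 'I_m -> {mpoly C[n]},
    forall G, vanishing (Z m) (mmap (@mpolyC n C) g G) -> G = 0.
Proof.
elim: m => [|m IH] irr str.
  exists (fun=> 0) => G; rewrite (nvar0_mpolyC G) mmapC => h.
  have [_ [[p Zp] _]] := irr 0%N (leqnn 0%N).
  by have := h p Zp; rewrite mevalC => ->; rewrite mpolyC0.
have [||g gP] := IH; [by move=> j /leqW/irr|by move=> j /leqW/str|].
have [sub [p [Zp Zmp]]] := str m (leqnn _).
have [f [Zf fp]] := zclosed_vanishing_neq0 (irr m (leqnSn m)).1 Zmp.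
exists (ext g f) => G; rewrite mmap_ext => h; apply/eqP; rewrite -muni_eq0; apply/eqP.
move: (muni G) h; elim/poly_ind => [//|H c IHH].
rewrite rmorphD rmorphM /= map_polyX map_polyC !hornerE /= => h.
have c0 : c = 0.
  apply: gP => q Zq; have := h q (sub q Zq).
  by rewrite mevalD mevalM (Zf q Zq) mulr0 add0r.
rewrite c0 mmap0 addr0 in h.
have [/IHH ->|fv] := vanishing_prime (irr m.+1 (leqnn _)) h.
  by rewrite c0 mul0r addr0.
by rewrite (fv p Zp) eqxx in fp.
Qed.

Lemma has_chain_rimage_le m : has_chain m Y -> (m <= \rank rjac)%N.
Proof.
move=> [Z [Z1 Z2]].
have [|g gP] := chain_independent _ Z2; first by move=> j /Z1[].
pose h i := mmap (cst C k) rfrac (g i).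
have ih : aindep (cst C k) h.
  move=> G; rewrite -mmap_comp => /vanishing_rimage GY; apply: gP => p Zp.
  by apply: GY; have [_] := Z1 m (leqnn m); apply.
have fr := aindep_jac_free (@fDD C k) (@fDM C k) (@fDC C k) (@fDX C k) (@alg_dep C k) ih.
move: fr; rewrite rjac_chain /row_free => /eqP <-.
exact: mxrankM_maxr.
Qed.

Lemma tangent_rjac u (w : 'cV[C]_k) : B.@[u] != 0 ->
  tangent_space Y (rval_at u) (fun i => (rjac_at u *m w) i 0).
Proof.
move=> Bu f /vanishing_rimage f0.
have z : (\row_i (f^`M(i)).@[rval_at u]) *m rjac_at u = 0.
  apply/rowP => j; rewrite [RHS]mxE; apply: (@evals0 _ _ u).
  rewrite -(derivation0 (fDC j)) -f0 (chain_rule (fDD j) (fDM j) (fDC j)) mxE.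
  apply: evals_sum => i; apply: evalsM; last by have := evals_rjac Bu i j; rewrite mxE.
  by rewrite mxE; apply: evals_mmap; apply: evals_rfrac.
transitivity (((\row_i (f^`M(i)).@[rval_at u]) *m (rjac_at u *m w)) 0 0).
  by rewrite [RHS]mxE; apply: eq_bigr => i _; rewrite [in RHS]mxE.
by rewrite mulmxA z mul0mx mxE.
Qed.

Lemma generic_rank_rjac : generic (fun u => B.@[u] != 0 /\ \rank (rjac_at u) = \rank rjac).
Proof.
apply: generic_imp (genericI (generic_nz B0) (evalmx_rank rjac)) => u [Bu h].
by split=> //; apply: h; apply: evals_rjac.
Qed.

Lemma tangent_rimage : generic (fun u => B.@[u] != 0 /\
  forall v, tangent_space Y (rval_at u) v ->
    exists w : 'cV[C]_k, forall i, v i = (rjac_at u *m w) i 0).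
Proof.
have [I [H [fr HP]]] :=
  tangent_relations (@fDD C k) (@fDM C k) (@fDC C k) (@fDX C k) (@alg_dep C k) rfrac.
have gH : generic (fun u => forall j, forall v,
    evals u (map_poly (mmap (cst C k) (rfrac \o I)) (H j)^`()).[rfrac j] v -> v != 0).
  by apply: generic_fin => j; apply: evals_generic_neq0; case: (HP j).
have gI := evalmx_rank (jac (@fD C k) (rfrac \o I)).
apply: generic_imp (genericI (generic_nz B0) (genericI gH gI)) => u [Bu [Hu Iu]].
split=> // v Tv.
have frI : row_free (rowsub I (rjac_at u)).
  rewrite /row_free Iu; first exact: fr.
  by move=> i j; have := evals_rjac Bu (I i) j; rewrite !mxE.
have {frI} [X NX] := row_freeP frI.
pose w := X *m (\col_i v (I i)); exists w => j; apply/eqP; rewrite -subr_eq0; apply/eqP.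
pose z i := v i - (rjac_at u *m w) i 0.
have Tz : tangent_space Y (rval_at u) z.
  move=> f Yf; rewrite /pairing; under eq_bigr do rewrite mulrBr.
  by rewrite sumrB; have := Tv f Yf; have := tangent_rjac w Bu Yf;
     rewrite /pairing => -> ->; rewrite subrr.
have zI i : z (I i) = 0.
  rewrite /z; suff -> : (rjac_at u *m w) (I i) 0 = v (I i) by rewrite subrr.
  transitivity ((rowsub I (rjac_at u) *m w) i 0).
    by rewrite !mxE; apply: eq_bigr => l _; rewrite !mxE.
  by rewrite /w mulmxA NX mul1mx mxE.
rewrite -/(z j).
pose gI' := fun i => 'X_(I i) : {mpoly C[n]}.
pose P := (map_poly (mmap (@mpolyC n C) gI') (H j)).['X_j].
have YP : vanishing Y P.
  apply/vanishing_rimage; rewrite mmap_comp_horner mmapX mmap1U.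
  rewrite -[RHS](HP j).1; congr (map_poly (mmap _ _) _).[_].
  by apply: funext => i; rewrite mmapX mmap1U.
have := Tz P YP; rewrite /pairing /grad.
have dP b : P^`M(b) = \sum_i (map_poly (mmap (@mpolyC n C) gI') (map_poly (mderiv i) (H j))).['X_j] * (gI' i)^`M(b) +
     (map_poly (mmap (@mpolyC n C) gI') (H j)^`()).['X_j] * ('X_j)^`M(b).
  apply: (@chain_rule_horner C _ (@mpolyC n C) (mderiv b)).
  - exact: mderivD.
  - exact: mderivM.
  - by move=> c; rewrite /= mderivC.
under eq_bigr => b _ do rewrite dP mevalD raddf_sum mulrDl mulr_suml.
rewrite big_split exchange_big /=.
have single (c : {mpoly C[n]}) l :
    \sum_b (c * ('X_l)^`M(b)).@[rval_at u] * z b = c.@[rval_at u] * z l.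
  rewrite (bigD1 l) //= big1 ?addr0 => [|b nb].
    by rewrite mderiv_U eqxx mpolyC1 mulr1.
  by rewrite mderiv_U eq_sym (negbTE nb) mpolyC0 mulr0 meval0 mul0r.
rewrite big1 ?add0r => [|i _]; last by rewrite single zI mulr0.
rewrite single => /eqP; rewrite mulf_eq0 => /orP[|/eqP //].
have : (map_poly (mmap (@mpolyC n C) gI') (H j)^`()).['X_j].@[rval_at u] != 0.
  apply: (Hu j); rewrite /meval mmap_comp_horner.
  have -> : mmap idfun (rval_at u) 'X_j = rval_at u j by exact: mevalXU.
  apply: evals_horner; last exact: evals_rfrac.
  by move=> i /=; rewrite -/(meval _ _) mevalXU; apply: evals_rfrac.
by move/negbTE ->.
Qed.

End RationalImage.

Section Restriction.
Variables (R : realType) (k l n : nat).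
Local Notation C := R[i].
Variables (A : 'I_n -> {mpoly C[k]}) (B : {mpoly C[k]}).
Variables (c : 'I_l -> 'I_k) (u : 'I_k -> C).
Hypothesis c_inj : injective c.

Definition freeze_var (j : 'I_k) : {mpoly C[l]} :=
  if [pick i | c i == j] is Some i then 'X_i else (u j)%:MP.
Definition freeze (p : {mpoly C[k]}) : {mpoly C[l]} := mmap (@mpolyC l C) freeze_var p.

Lemma freeze_eval p v : (freeze p).@[v] = p.@[fun j => (freeze_var j).@[v]].
Proof. exact: mmap_comp. Qed.

Lemma freeze_at p : (freeze p).@[u \o c] = p.@[u].
Proof.
rewrite freeze_eval; apply: meval_eq => j; rewrite /freeze_var.
case: pickP => [i /eqP <-|_]; by rewrite ?mevalXU ?mevalC.
Qed.

Lemma freeze_deriv p i : (freeze p)^`M(i) = freeze p^`M(c i).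
Proof.
rewrite /freeze (@chain_rule C _ (@mpolyC l C) (mderiv i) (mderivD i) (mderivM i)); last first.
  by move=> a; rewrite /= mderivC.
rewrite (bigD1 (c i)) //= big1 ?addr0.
  rewrite /freeze_var; case: pickP => [i' /eqP/c_inj ->|/(_ i)]; last by rewrite eqxx.
  by rewrite mderiv_U eqxx mpolyC1 mulr1.
move=> j nj; rewrite /freeze_var; case: pickP => [i' /eqP e|_]; last by rewrite mderivC mulr0.
rewrite mderiv_U; case: eqP => [e'|_]; last by rewrite mpolyC0 mulr0.
by move: nj; rewrite -e e' eqxx.
Qed.

Lemma rimage_freeze : subset (rimage (fun i => freeze (A i)) (freeze B)) (rimage A B).
Proof.
move=> p [v [Bv ->]]; exists (fun j => (freeze_var j).@[v]); rewrite -(freeze_eval B); split=> //.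
apply: funext => i; rewrite /rval_at; congr (_ / _); last exact: freeze_eval.
exact: freeze_eval.
Qed.

Lemma rjac_at_freeze :
  rjac_at (fun i => freeze (A i)) (freeze B) (u \o c) = colsub c (rjac_at A B u).
Proof. apply/matrixP => i j; rewrite !mxE; congr ((_ * _ - _ * _) / _ ^+ 2).
- by rewrite freeze_deriv freeze_at.
- by rewrite freeze_at.
- by rewrite freeze_at.
- by rewrite freeze_deriv freeze_at.
- by rewrite freeze_at. Qed.

End Restriction.

Section RationalChains.
Variable (R : realType).
Local Notation C := R[i].

(* Freezing the last variable gives a strictly smaller closure: k + 1 of the
   coordinates are independent, and become dependent as functions of the k
   remaining variables. *)
Lemma has_chain_full_rank k n (A : 'I_n -> {mpoly C[k]}) B u :
  B.@[u] != 0 -> \rank (rjac_at A B u) = k -> has_chain k (zclosure (rimage A B)).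
Proof.
elim: k A B u => [|k IH] A B u Bu rk.
  exists (fun=> zclosure (rimage A B)); split=> // j _; split=> //.
  exact/irreducible_rimage/(meval_neq0 Bu).
have B0 := meval_neq0 Bu.
pose c := lift (@ord_max k); have c_inj : injective c by exact: lift_inj.
pose A' i := freeze c u (A i); pose B' := freeze c u B.
have Bu' : B'.@[u \o c] != 0 by rewrite freeze_at.
have B0' := meval_neq0 Bu'.
have rk' : \rank (rjac_at A' B' (u \o c)) = k.
  rewrite rjac_at_freeze //; apply/eqP; rewrite -mxrank_tr.
  have : row_free (rjac_at A B u)^T by rewrite /row_free mxrank_tr rk.
  case/row_freeP => X /(congr1 (mxsub c c)) XE.
  apply/row_freeP; exists (colsub c X); rewrite trmx_mxsub -mxsub_mul XE.
  by apply/matrixP => i j; rewrite !mxE (inj_eq c_inj).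
apply: has_chain_snoc (IH _ _ _ Bu' rk').
- exact: irreducible_rimage.
- exact/zclosureS/rimage_freeze.
pose I := maxrankfun (rjac_at A B u).
have ltk : (k < \rank (rjac_at A B u))%N by rewrite rk.
have /existsNP[G /not_implyP[G0 Gn]] := alg_dep (g := rfrac A' B' \o I) ltk.
have ind : aindep (cst C k.+1) (rfrac A B \o I).
  apply: (jac_free_aindep (@fDD C k.+1) (@fDM C k.+1) (@fDC C k.+1)).
  apply: (@evalmx_row_free _ _ u _ _ _ (rowsub I (rjac_at A B u))); last exact: maxrowsub_free.
  by move=> i j; have := evals_rjac A Bu (I i) j; rewrite !mxE.
pose f := mmap (@mpolyC n C) (fun i => 'X_(I i)) G.
have Yf' : vanishing (zclosure (rimage A' B')) f.
  by apply/vanishing_rimage => //; rewrite mmap_id_proj.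
have /existsNP[p /not_implyP[Yp fp]] : ~ vanishing (zclosure (rimage A B)) f.
  by move=> /(vanishing_rimage _ B0); rewrite mmap_id_proj => /ind.
by exists p; split=> // /Yf'.
Qed.

Lemma has_chain_rimage k n (A : 'I_n -> {mpoly C[k]}) B : B != 0 ->
  has_chain (\rank (rjac A B)) (zclosure (rimage A B)).
Proof.
move=> B0; have [u [Bu <-]] := generic_ex (generic_rank_rjac A B0).
rewrite -mxrank_tr; pose c := maxrankfun (rjac_at A B u)^T.
have c_inj : injective c by exact: maxrankfun_inj.
refine (has_chainS (zclosureS (rimage_freeze (c := c) (u := u))) _).
apply: (@has_chain_full_rank _ _ _ _ (u \o c)); first by rewrite freeze_at.
rewrite rjac_at_freeze // -[LHS]mxrank_tr trmx_mxsub.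
by apply/eqP/(maxrowsub_free (rjac_at A B u)^T).
Qed.

Lemma var_dim_rimage k n (A : 'I_n -> {mpoly C[k]}) B : B != 0 ->
  var_dim (zclosure (rimage A B)) (\rank (rjac A B)).
Proof.
move=> B0; split; first exact: has_chain_rimage.
by move/(has_chain_rimage_le B0); rewrite ltnn.
Qed.

Lemma tangent_rimageE k n (A : 'I_n -> {mpoly C[k]}) B : B != 0 ->
  generic (fun u => B.@[u] != 0 /\ forall v,
    tangent_space (zclosure (rimage A B)) (rval_at A B u) v <->
    (rowv v <= (rjac_at A B u)^T)%MS).
Proof.
move=> B0; apply: generic_imp (tangent_rimage A B0) => u [Bu h]; split=> // v; split.
  case/h => w vE; suff -> : rowv v = w^T *m (rjac_at A B u)^T by exact: submxMl.
  by rewrite -trmx_mul; apply/rowP => i; rewrite !mxE vE mxE.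
case/submxP => w /(congr1 trmx); rewrite trmx_mul trmxK => vE.
have -> : v = fun i => (rjac_at A B u *m w^T) i 0.
  by apply: funext => i; rewrite -vE !mxE.
exact: tangent_rjac.
Qed.

Lemma smooth_rimage k n (A : 'I_n -> {mpoly C[k]}) B : B != 0 ->
  generic (fun u => smooth_point (zclosure (rimage A B)) (rval_at A B u)).
Proof.
move=> B0.
apply: generic_imp (genericI (tangent_rimageE A B0) (generic_rank_rjac A B0)) => u [[Bu h] [_ rk]].
split; first exact: rimage_at.
exists (\rank (rjac A B)); split; first exact: var_dim_rimage.
by rewrite -rk -mxrank_tr; apply: lin_dim_rowspace.
Qed.

End RationalChains.

(** * Bases of vanishing ideals *)

Lemma nondecreasing_subsequence (f : nat -> nat) : exists s : nat -> nat,
  (forall i j, (i < j)%N -> (s i < s j)%N) /\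
  forall i j, (i <= j)%N -> (f (s i) <= f (s j))%N.
Proof.
have nxt m : exists j, (m < j)%N /\ forall l, (m < l)%N -> (f j <= f l)%N.
  have ex : exists v, `[< exists2 j, (m < j)%N & f j = v >].
    by exists (f m.+1); apply/asboolP; exists m.+1.
  case: (ex_minnP ex) => v /asboolP[j mj fj] vmin; exists j; split=> // l ml.
  by rewrite fj; apply: vmin; apply/asboolP; exists l.
have [t tP] := choice nxt.
have incr i : (iter i t 0 < iter i.+1 t 0)%N by have [] := tP (iter i t 0).
have mono i j : (i < j)%N -> (iter i t 0 < iter j t 0)%N.
  by elim: j => // j IH; rewrite ltnS leq_eqVlt => /orP[/eqP->//|/IH/ltn_trans]; apply.
exists (fun i => iter i.+1 t 0); split=> [i j ij|i j]; first exact: mono.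
rewrite leq_eqVlt => /orP[/eqP->//|ij].
by have [_] := tP (iter i t 0); apply; apply: mono; apply: ltnW.
Qed.

Lemma dickson_sequence n (F : nat -> 'X_{1..n}) : exists i j, (i < j)%N /\ (F i <= F j)%MM.
Proof.
have [s [s1 s2]] : exists s : nat -> nat, (forall i j, (i < j)%N -> (s i < s j)%N) /\
    forall c, c \in enum 'I_n -> forall i j, (i <= j)%N -> (F (s i) c <= F (s j) c)%N.
  elim: (enum 'I_n) => [|c e [s [s1 s2]]]; first by exists id.
  have [t [t1 t2]] := nondecreasing_subsequence (fun i => F (s i) c).
  exists (s \o t); split=> [i j /t1/s1 //|c'].
  rewrite inE => /orP[/eqP->|ce] i j ij; first exact: t2.
  apply: s2 => //; move: ij; rewrite leq_eqVlt => /orP[/eqP->//|/t1]; exact: ltnW.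
exists (s 0%N), (s 1%N); split; first exact: s1.
by apply/mnm_lepP => c; apply: s2; rewrite ?mem_enum.
Qed.

Lemma dickson n (M : 'X_{1..n} -> Prop) : exists s : seq 'X_{1..n},
  (forall m, m \in s -> M m) /\ forall m, M m -> exists2 m', m' \in s & (m' <= m)%MM.
Proof.
apply: contrapT => no.
have nxt (s : seq 'X_{1..n}) : exists m, (forall x, x \in s -> M x) ->
    M m /\ forall x, x \in s -> ~~ (x <= m)%MM.
  apply: contrapT => no'; apply: no; exists s; split.
    by move=> m ms; apply: contrapT => Mm; apply: no'; exists m => h; case: Mm; apply: h.
  move=> m Mm; apply: contrapT => nm; apply: no'; exists m => _; split=> // x xs.
  by apply/negP => xm; apply: nm; exists x.
have [t tP] := choice nxt.
pose q := fix q i := if i is j.+1 then t (q j) :: q j else [::].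
have qM i x : x \in q i -> M x.
  elim: i x => // i IH x; rewrite inE => /orP[/eqP->|/IH //].
  by have [] := tP (q i) (IH).
have qin i j : (i < j)%N -> t (q i) \in q j.
  elim: j => // j IH; rewrite ltnS leq_eqVlt inE => /orP[/eqP->|/IH ->]; first by rewrite eqxx.
  by rewrite orbT.
have [i [j [ij le]]] := dickson_sequence (fun i => t (q i)).
by have [_ /(_ _ (qin _ _ ij))] := tP (q j) (@qM j); rewrite le.
Qed.

Lemma hilbert_basis (C : fieldType) n (Id : {mpoly C[n]} -> Prop) :
  (forall f g, Id f -> Id g -> Id (f + g)) -> (forall f g, Id g -> Id (f * g)) ->
  exists r (b : 'I_r -> {mpoly C[n]}), (forall i, Id (b i)) /\
    forall f, Id f -> exists a : 'I_r -> {mpoly C[n]}, f = \sum_i a i * b i.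
Proof.
move=> ID IM.
have [s [sM sP]] := dickson (fun m => exists f, [/\ Id f, f != 0 & mlead f = m]).
have wit (i : 'I_(size s)) : exists f, [/\ Id f, f != 0 & mlead f = tnth (in_tuple s) i].
  by apply: sM; apply: mem_tnth.
have [b bP] := choice wit; exists (size s), b; split=> [i|f]; first by case: (bP i).
have [->|] := eqVneq f 0; first by exists (fun=> 0); rewrite big1 // => i _; rewrite mul0r.
move: {2}(mlead f) (erefl (mlead f)) => m; elim/(well_founded_ind (@ltom_wf n)): m f.
move=> m IH f fm f0 If.
have [_ /(tnthP (in_tuple s))[i ->] le] : exists2 m', m' \in s & (m' <= mlead f)%MM.
  by apply: sP; exists f.
have [Ib b0 bi] := bP i; rewrite -{}bi in le.
pose q := (mleadc f / mleadc (b i)) *: 'X_[mlead f - mlead (b i)].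
pose h := f - q * b i.
have lc0 g : g != 0 -> mleadc g != 0 :> C by rewrite mleadc_eq0.
have q0 : q != 0.
  rewrite scaler_eq0 negb_or mulf_neq0 ?invr_eq0 ?lc0 //=.
  by rewrite -msize_poly_eq0 msizeX.
have ql : mlead q = (mlead f - mlead (b i))%MM.
  by rewrite mleadZ ?mleadXm // mulf_neq0 ?invr_eq0 ?lc0.
have qbl : mlead (q * b i) = mlead f by rewrite mleadM // ql submK.
have hf : h@_(mlead f) = 0.
  rewrite mcoeffB -[in X in _ - X]qbl mleadM // mleadcM ql mcoeffZ mcoeffX eqxx mulr1.
  by rewrite divfK ?lc0 // subrr.
have fE : f = h + q * b i by rewrite subrK.
have Ih : Id h by rewrite /h -mulNr; apply: ID => //; apply: IM.
have [a ha] : exists a, h = \sum_i a i * b i.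
  have [->|h0] := eqVneq h 0; first by exists (fun=> 0); rewrite big1 // => j _; rewrite mul0r.
  apply: (IH (mlead h)) => //; rewrite -fm lt_neqAle; apply/andP; split.
    by apply: contraTneq (mlead_supp h0) => ->; rewrite mcoeff_msupp hf eqxx.
  by have := mleadB_le f (q * b i); rewrite qbl joinxx.
exists (fun j => a j + (if j == i then q else 0)).
rewrite {1}fE ha [RHS](eq_bigr _ (fun j _ => mulrDl _ _ _)) big_split /=; congr (_ + _).
rewrite (bigD1 i) //= eqxx big1 ?addr0 // => j /negbTE ->; exact: mul0r.
Qed.

Section VanishingBasis.
Variables (R : realType) (n : nat).
Local Notation C := R[i].
Implicit Type Y : ('I_n -> C) -> Prop.

Definition vanishing_basis Y r (b : 'I_r -> {mpoly C[n]}) :=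
  (forall i, vanishing Y (b i)) /\
  forall f, vanishing Y f -> exists a : 'I_r -> {mpoly C[n]}, f = \sum_i a i * b i.

Lemma vanishing_basis_ex Y : exists r (b : 'I_r -> {mpoly C[n]}), vanishing_basis Y b.
Proof.
apply: hilbert_basis => f g.
  by move=> Yf Yg p Yp; rewrite mevalD Yf ?Yg ?addr0.
by move=> Yg p Yp; rewrite mevalM Yg ?mulr0.
Qed.

Definition grads r (b : 'I_r -> {mpoly C[n]}) (p : 'I_n -> C) : 'M[C]_(r, n) :=
  \matrix_(i, j) (b i)^`M(j).@[p].

Lemma grads_mulE r (b : 'I_r -> {mpoly C[n]}) p v i :
  (grads b p *m (rowv v)^T) i 0 = pairing (grad (b i) p) v.
Proof. by rewrite mxE; apply: eq_bigr => j _; rewrite !mxE. Qed.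

Variables (Y : ('I_n -> C) -> Prop) (r : nat) (b : 'I_r -> {mpoly C[n]}).
Hypothesis bY : vanishing_basis Y b.

Lemma basis_zclosed p : zclosed Y -> Y p <-> forall i, (b i).@[p] = 0.
Proof.
move=> cY; split=> [Yp i|h]; first by apply: bY.1.
apply/(zclosure_id cY) => f /bY.2[a ->]; rewrite raddf_sum big1 //= => i _.
by rewrite mevalM h mulr0.
Qed.

Lemma tangent_grads p v : Y p -> tangent_space Y p v <-> grads b p *m (rowv v)^T = 0.
Proof.
move=> Yp; split=> [h|h f].
  by apply/colP => i; rewrite grads_mulE mxE h //; apply: bY.1.
case/bY.2 => a ->; rewrite /pairing /grad.
under eq_bigr => j _ do rewrite (raddf_sum (mderiv j)) (raddf_sum (meval p)) /= mulr_suml.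
rewrite exchange_big big1 //= => i _.
transitivity ((a i).@[p] * \sum_j (b i)^`M(j).@[p] * v j).
  rewrite mulr_sumr; apply: eq_bigr => j _.
  by rewrite mderivM mevalD !mevalM (bY.1 _ _ Yp) mulr0 add0r mulrA.
have := grads_mulE b p v i; rewrite h mxE /pairing /grad => <-.
by rewrite mulr0.
Qed.

Lemma tangent_kermx p v : Y p ->
  tangent_space Y p v <-> (rowv v <= kermx (grads b p)^T)%MS.
Proof.
move=> Yp; rewrite tangent_grads //; split=> [/(congr1 trmx)|/sub_kermxP/(congr1 trmx)].
  by rewrite trmx_mul trmxK trmx0 => /sub_kermxP.
by rewrite trmx_mul trmxK trmx0.
Qed.

Lemma lin_dim_tangent p : Y p ->
  lin_dim (tangent_space Y p) (n - \rank (grads b p)).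
Proof.
move=> Yp; rewrite -mxrank_tr -mxrank_ker; apply: lin_dim_rowspace => v.
exact: tangent_kermx.
Qed.

Lemma conormal_grads p g : Y p ->
  (forall v, tangent_space Y p v -> pairing g v = 0) <-> (rowv g <= grads b p)%MS.
Proof.
move=> Yp; split=> [h|/submxP[c cE] v /(tangent_grads _ Yp) Tv].
  rewrite submxE; apply/eqP/rowP => j; rewrite [RHS]mxE.
  rewrite -[RHS](h (fun i => cokermx (grads b p) i j)).
    by rewrite mxE; apply: eq_bigr => i _; rewrite mxE.
  apply/tangent_grads => //; apply/colP => i.
  have e : (grads b p *m cokermx (grads b p)) i j = 0 by rewrite mulmx_coker mxE.
  rewrite [RHS]mxE -[RHS]e [LHS]mxE [RHS]mxE; apply: eq_bigr => l _.
  by rewrite [(rowv _)^T _ _]mxE [rowv _ _ _]mxE.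
transitivity ((rowv g *m (rowv v)^T) 0 0).
  by rewrite mxE /pairing; apply: eq_bigr => j _; rewrite !mxE.
by rewrite cE -mulmxA Tv mulmx0 mxE.
Qed.

Lemma conormal_grad p g : Y p ->
  (forall v, tangent_space Y p v -> pairing g v = 0) ->
  exists f, vanishing Y f /\ forall j, g j = (f^`M(j)).@[p].
Proof.
move=> Yp /(conormal_grads _ Yp)/submxP[c cE].
exists (\sum_i (c 0 i)%:MP * b i); split.
  by apply: vanishing_lincomb => i; apply: bY.1.
move=> j; have /rowP/(_ j) := cE; rewrite !mxE => ->.
rewrite (raddf_sum (mderiv j)) (raddf_sum (meval p)) /=; apply: eq_bigr => i _.
by rewrite mxE mderiv_mulC mevalM mevalC.
Qed.

End VanishingBasis.

(** * Solutions of the homaloidal PDE *)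

Section Translation.
Variables (C : numFieldType) (K : fieldType) (io : {rmorphism C -> K}).
Variable D : K -> K.
Hypothesis DD : forall x y, D (x + y) = D x + D y.
Hypothesis DM : forall x y, D (x * y) = D x * y + x * D y.
Hypothesis DC : forall c, D (io c) = 0.

Let D0 : D 0 = 0 := derivation0 DC.

Let Dcoef q i : (map_poly D q)`_i = D q`_i.
Proof. exact: coef_map_id0. Qed.

Let Dsum (I : Type) (r : seq I) (Q : pred I) (x : I -> K) :
  D (\sum_(i <- r | Q i) x i) = \sum_(i <- r | Q i) D (x i).
Proof. exact: (big_morph D DD D0). Qed.

Let delta (q : {poly K}) := q^`() - map_poly D q.

Let polyio : {rmorphism C -> {poly K}} := (@polyC K \o io)%FUN.

Let deltaD p q : delta (p + q) = delta p + delta q.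
Proof.
apply/polyP => i; rewrite /delta derivD !(coefD, coefN) !Dcoef coefD DD.
by rewrite opprD addrACA.
Qed.

Let deltaM p q : delta (p * q) = delta p * q + p * delta q.
Proof.
have -> : delta p * q + p * delta q =
    p^`() * q + p * q^`() - (map_poly D p * q + p * map_poly D q).
  by rewrite /delta mulrBl mulrBr opprD addrACA.
rewrite {1}/delta derivM; congr (_ - _); apply/polyP => i.
rewrite Dcoef coefD !coefM Dsum -big_split /=; apply: eq_bigr => j _.
by rewrite DM !Dcoef.
Qed.

Let deltaC c : delta (polyio c) = 0.
Proof.
rewrite /delta /polyio /= derivC sub0r; apply/polyP => i.
by rewrite coefN Dcoef !coefC; case: eqP; rewrite ?DC ?D0 oppr0.
Qed.

Let deltaK x : delta x%:P = - (D x)%:P.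
Proof.
rewrite /delta derivC sub0r; congr (- _); apply/polyP => i.
by rewrite Dcoef !coefC; case: eqP; rewrite ?D0.
Qed.

Let delta_ker q : delta q = 0 -> q`_0 = 0 -> q = 0.
Proof.
move=> /polyP dq q0; apply/polyP => i; rewrite coef0; elim: i => // i IH.
have := dq i; rewrite coefB coef_deriv Dcoef IH D0 subr0 coef0 => /eqP.
rewrite -mulr_natr mulf_eq0 => /orP[/eqP //|].
by rewrite -(rmorph_nat io) fmorph_eq0 pnatr_eq0.
Qed.

Lemma mmap_horner m (g : 'I_m -> {poly K}) c h :
  (mmap polyio g h).[c] = mmap io (fun j => (g j).[c]) h.
Proof.
elim/mpoly_ring_ind: h => [a|i|p q Hp Hq|p q Hp Hq].
- by rewrite !mmapC /= hornerC.
- by rewrite !mmapX !mmap1U.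
- by rewrite !mmapD hornerD Hp Hq.
- by rewrite [mmap polyio g _]rmorphM hornerM /= Hp Hq [RHS]rmorphM.
Qed.

(* If a derivation D sends the coordinates X to a D-constant vector w, then
   h(X + t w) is killed by d/dt - D for every polynomial h, so an element of
   K[t] of the form a(X + t w) - x b(X + t w) with D x = 0 is determined by
   its value at t = 0. *)
Lemma translation_invariance m (X w : 'I_m -> K) x (a b : {mpoly C[m]}) :
  (forall j, D (X j) = w j) -> (forall j, D (w j) = 0) -> D x = 0 ->
  mmap io X a = x * mmap io X b ->
  mmap io (fun j => X j + w j) a = x * mmap io (fun j => X j + w j) b.
Proof.
move=> DX Dw Dx ab; pose g j : {poly K} := (X j)%:P + (w j)%:P * 'X.
have dg j : delta (g j) = 0.
  rewrite deltaD deltaM !deltaK DX Dw oppr0 mul0r add0r.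
  rewrite /delta derivX; suff -> : map_poly D 'X = 0 by rewrite subr0 mulr1 addNr.
  apply/polyP => i; rewrite Dcoef coefX coef0.
  by case: (i == 1%N); rewrite ?D0 // -(rmorph1 io) DC.
have ds h : delta (mmap polyio g h) = 0.
  rewrite (chain_rule deltaD deltaM deltaC) big1 // => i _.
  by rewrite dg mulr0.
have /(congr1 (fun q => q.[1])) : mmap polyio g a - x%:P * mmap polyio g b = 0.
  apply: delta_ker.
    have dN q : delta (- q) = - delta q.
      by apply/eqP; rewrite -addr_eq0 -deltaD addNr; apply/eqP/(derivation0 deltaC).
    by rewrite deltaD dN deltaM !ds deltaK Dx oppr0 mul0r mulr0 addr0 oppr0 addr0.
  rewrite -horner_coef0 hornerD hornerN hornerM hornerC !mmap_horner.
  have -> : (fun j => (g j).[0]) = X.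
    by apply: funext => j; rewrite /g !hornerE.
  by rewrite ab subrr.
rewrite horner0 hornerD hornerN hornerM hornerC !mmap_horner => /eqP.
have -> : (fun j => (g j).[1]) = fun j => X j + w j.
  by apply: funext => j; rewrite /g !hornerE.
by rewrite subr_eq0 => /eqP.
Qed.

End Translation.

Section Homogeneous.
Variables (C : numFieldType) (n : nat).
Implicit Type p : {mpoly C[n]}.

Definition euler p := \sum_(i < n) 'X_i * p^`M(i).

Lemma eulerD p q : euler (p + q) = euler p + euler q.
Proof.
by rewrite /euler -big_split /=; apply: eq_bigr => i _; rewrite mderivD mulrDr.
Qed.

Lemma eulerZ c p : euler (c *: p) = c *: euler p.
Proof.
by rewrite /euler scaler_sumr; apply: eq_bigr => i _; rewrite mderivZ scalerAr.
Qed.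

Lemma eulerX m : euler 'X_[m] = (mdeg m)%:R *: 'X_[m] :> {mpoly C[n]}.
Proof.
rewrite /euler mdegE natr_sum scaler_suml; apply: eq_bigr => i _.
rewrite mderivX -scalerAr; have [->|mi] := eqVneq (m i) 0%N; first by rewrite !scale0r.
by rewrite -mpolyXD addmC submK // lep1mP.
Qed.

Lemma mcoeff_euler p m : (euler p)@_m = (mdeg m)%:R * p@_m.
Proof.
elim/mpolyind: p => [|c m' p _ _ IH].
  by rewrite /euler big1 ?mcoeff0 ?mulr0 // => i _; rewrite mderiv0 mulr0.
rewrite eulerD eulerZ eulerX !mcoeffD IH !mcoeffZ !mcoeffX mulrDr; congr (_ + _).
by case: eqP => [->|]; rewrite ?mulr0 // !mulr1 mulrC.
Qed.

End Homogeneous.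

Lemma clear_denominators (C : numFieldType) m n (s : 'I_m -> {mpoly C[n]}) (F : {mpoly C[n]})
  (h : {mpoly C[m]}) : exists N (H : {mpoly C[n]}), forall p, F.@[p] != 0 ->
  H.@[p] = F.@[p] ^+ N * h.@[fun j => (s j).@[p] / F.@[p]].
Proof.
elim/mpoly_ring_ind: h => [c|i|a b [N1 [H1 h1]] [N2 [H2 h2]]|a b [N1 [H1 h1]] [N2 [H2 h2]]].
- by exists 0%N, c%:MP => p _; rewrite !mevalC expr0 mul1r.
- by exists 1%N, (s i) => p Fp; rewrite mevalXU expr1 mulrC divfK.
- exists (N1 + N2)%N, (F ^+ N2 * H1 + F ^+ N1 * H2) => p Fp.
  rewrite !mevalD !mevalM !rmorphXn /= h1 // h2 // mulrDr exprD; congr (_ + _).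
    by rewrite mulrA; congr (_ * _); rewrite mulrC.
  by rewrite mulrA.
- exists (N1 + N2)%N, (H1 * H2) => p Fp.
  by rewrite !mevalM h1 // h2 // exprD mulrACA.
Qed.

Lemma neg_log_quotient (K : fieldType) (x y a b : K) : x != 0 -> y != 0 ->
  - (a / x - b / y) = (x * b - a * y) / (x * y).
Proof. by move=> x0 y0; field; rewrite x0 y0. Qed.

Lemma quotient_logderiv (K : fieldType) (x y a b : K) : x != 0 -> y != 0 ->
  (a * y - x * b) / y ^+ 2 = - (x / y) * ((x * b - a * y) / (x * y)).
Proof. by move=> x0 y0; field; rewrite x0 y0. Qed.

Lemma mmap_cst_fX (C : numFieldType) k (h : {mpoly C[k]}) :
  mmap (cst C k) (@fX C k) h = h%:F.
Proof.
elim/mpoly_ring_ind: h => [a|i|p q Hp Hq|p q Hp Hq].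
- by rewrite mmapC.
- by rewrite mmapX mmap1U.
- by rewrite mmapD Hp Hq tofracD.
- by rewrite [LHS]rmorphM /= Hp Hq tofracM.
Qed.

Lemma euler_homogeneous (C : numFieldType) n d (p : {mpoly C[n]}) :
  (forall m, m \in msupp p -> mdeg m = d) -> euler p = d%:R *: p.
Proof.
move=> hp; apply/mpolyP => m; rewrite mcoeff_euler mcoeffZ.
have [/hp ->//|] := boolP (m \in msupp p).
by move/memN_msupp_eq0 ->; rewrite !mulr0.
Qed.

Section LogGradient.
Variables (C : numFieldType) (K : fieldType) (io : {rmorphism C -> K}) (n : nat).
Variables (D : 'I_n -> K -> K) (X : 'I_n -> K).
Hypothesis DD : forall j x y, D j (x + y) = D j x + D j y.
Hypothesis DM : forall j x y, D j (x * y) = D j x * y + x * D j y.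
Hypothesis DC : forall j c, D j (io c) = 0.
Hypothesis DX : forall i j, D j (X i) = (i == j)%:R.
Hypothesis Dcomm : forall i j x, D i (D j x) = D j (D i x).
Variables (Phi : K) (phi : 'I_n -> K) (c : C).
Hypothesis Phi0 : Phi != 0.
Hypothesis DPhi : forall j, D j Phi = - Phi * phi j.

Let DN j x : D j (- x) = - D j x.
Proof. by apply/eqP; rewrite -addr_eq0 -DD addNr (derivation0 (DC j)). Qed.

Lemma log_gradient_sym i j : D i (phi j) = D j (phi i).
Proof.
have := Dcomm i j Phi; rewrite !DPhi !DM !DN !DPhi !mulNr !opprK.
rewrite -[Phi * phi i * phi j]mulrA [phi i * _]mulrC mulrA.
by move/eqP; rewrite (inj_eq (addrI _)) eqr_opp => /eqP/(mulfI Phi0).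
Qed.

Hypothesis Xphi : \sum_i X i * phi i = io c.

Lemma log_gradient_pairing j : \sum_i X i * D j (phi i) = - phi j.
Proof.
have := congr1 (D j) Xphi; rewrite DC (big_morph (D j) (DD j) (derivation0 (DC j))).
under eq_bigr do rewrite DM DX.
rewrite big_split /= (bigD1 j) //= eqxx mul1r big1 ?addr0 => [/eqP|i /negbTE ->].
  by rewrite addrC addr_eq0 => /eqP.
by rewrite mul0r.
Qed.

Variable F : {mpoly C[n]}.
Hypothesis FPhi : mmap io phi F = Phi.

Lemma loglik_orthogonal j :
  \sum_i (mmap io phi F^`M(i) / mmap io phi F - X i) * D j (phi i) = 0.
Proof.
under eq_bigr do rewrite mulrBl; rewrite sumrB log_gradient_pairing opprK.
under eq_bigr do rewrite mulrAC.
rewrite -mulr_suml -(chain_rule (DD j) (DM j) (DC j)) FPhi DPhi.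
by rewrite !mulNr mulrAC divff ?Phi0 // mul1r addNr.
Qed.

End LogGradient.

Section ConormalTranslation.
Variables (C : numFieldType) (K : fieldType) (io : {rmorphism C -> K}) (n : nat).
Variables (D : 'I_n -> K -> K) (X phi : 'I_n -> K).
Hypothesis DD : forall j x y, D j (x + y) = D j x + D j y.
Hypothesis DM : forall j x y, D j (x * y) = D j x * y + x * D j y.
Hypothesis DC : forall j c, D j (io c) = 0.
Hypothesis DX : forall i j, D j (X i) = (i == j)%:R.
Hypothesis Dsym : forall i j, D i (phi j) = D j (phi i).

Lemma conormal_translation f i (a b : {mpoly C[n]}) :
  mmap io phi f = 0 -> mmap io X a = phi i * mmap io X b ->
  mmap io (fun j => X j + mmap io phi f^`M(j)) a =
  phi i * mmap io (fun j => X j + mmap io phi f^`M(j)) b.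
Proof.
move=> f0; pose w j := mmap io phi f^`M(j).
pose E x := \sum_j w j * D j x.
have ED x y : E (x + y) = E x + E y.
  by rewrite /E -big_split; apply: eq_bigr => j _; rewrite DD mulrDr.
have EM x y : E (x * y) = E x * y + x * E y.
  rewrite /E mulr_suml mulr_sumr -big_split; apply: eq_bigr => j _ /=.
  by rewrite DM mulrDr mulrA [w j * (x * _)]mulrCA.
have EC c : E (io c) = 0.
  by rewrite /E big1 // => j _; rewrite DC mulr0.
have EX j : E (X j) = w j.
  rewrite /E (bigD1 j) //= DX eqxx mulr1 big1 ?addr0 // => l nl.
  by rewrite DX eq_sym (negbTE nl) mulr0.
have Ephi l : E (phi l) = 0.
  rewrite /E -[RHS](derivation0 (DC l)) -[in RHS]f0 (chain_rule (DD l) (DM l) (DC l)).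
  by apply: eq_bigr => j _; rewrite Dsym.
have Ew j : E (w j) = 0.
  by rewrite (chain_rule ED EM EC) big1 // => l _; rewrite Ephi mulr0.
exact: (translation_invariance ED EM EC EX Ew (Ephi i)).
Qed.

End ConormalTranslation.

Section NegGradLog.
Variables (C : numFieldType) (n : nat) (P Q : {mpoly C[n]}).
Hypotheses (P0 : P != 0) (Q0 : Q != 0).

Definition ngl_num (i : 'I_n) := P * Q^`M(i) - P^`M(i) * Q.

Let B0 : P * Q != 0. Proof. by rewrite mulf_neq0. Qed.

Lemma fD_fraction j :
  fD j (P%:F / Q%:F) = - (P%:F / Q%:F) * ((ngl_num j)%:F / (P * Q)%:F).
Proof.
rewrite fD_frac // /ngl_num tofracB !tofracM.
by apply: quotient_logderiv; rewrite tofrac_neq0.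
Qed.

Lemma ngl_pairing (d1 d2 : nat) :
  (forall m, m \in msupp P -> mdeg m = d1) -> (forall m, m \in msupp Q -> mdeg m = d2) ->
  \sum_i fX C i * ((ngl_num i)%:F / (P * Q)%:F) = cst C n (d2%:R - d1%:R).
Proof.
move=> hP hQ; apply: (mulIf (tofrac_neq0 B0)); rewrite mulr_suml.
under eq_bigr => i _ do rewrite -mulrA divfK ?tofrac_neq0 // -tofracM.
rewrite -raddf_sum /= -tofracM; congr (_%:F).
rewrite mul_mpolyC scalerBl.
have <- : P * euler Q = d2%:R *: (P * Q) by rewrite (euler_homogeneous hQ) scalerAr.
have <- : euler P * Q = d1%:R *: (P * Q) by rewrite (euler_homogeneous hP) scalerAl.
rewrite /euler mulr_sumr mulr_suml -sumrB; apply: eq_bigr => i _.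
by rewrite /ngl_num mulrBr [X in X - _ = _]mulrCA; congr (_ - _); rewrite mulrA.
Qed.

End NegGradLog.

Lemma exchange_cancel (K : comNzRingType) (x y a b p : K) :
  a = p * b -> x * (y * a) - y * (p * (x * b)) = 0.
Proof. by move=> ->; ring. Qed.

Lemma evals_grad_loglik (R : realType) n (A : 'I_n -> {mpoly R[i][n]}) B F u i :
  B.@[u] != 0 -> F.@[rval_at A B u] != 0 ->
  evals u (mmap (cst R[i] n) (rfrac A B) F^`M(i) / mmap (cst R[i] n) (rfrac A B) F - fX R[i] i)
    (grad_loglik F u (rval_at A B u) i).
Proof.
move=> Bu Fp; have e := evals_rfrac A Bu; apply: evalsB; last first.
  by rewrite -[u i]mevalXU; apply: evals_poly.
apply: evalsM; first exact: evals_mmap.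
by apply: evalsV => //; apply: evals_mmap.
Qed.

Section GradientMap.
Variables (R : realType) (n : nat).
Local Notation C := R[i].
Variables (P Q : {mpoly C[n]}).
Hypotheses (P0 : P != 0) (Q0 : Q != 0).

Local Notation A := (ngl_num P Q).
Local Notation B := (P * Q).
Local Notation phi := (rfrac A B).
Local Notation Phi := (P%:F / Q%:F : {fraction {mpoly C[n]}}).
Local Notation Y := (zclosure (rimage A B)).
Local Notation X := (@fX C n).
Local Notation ev := (mmap (cst C n) phi).

Lemma rdefE u : rdef (P, Q) u = (B.@[u] != 0).
Proof. by rewrite /rdef mevalM. Qed.

Lemma neg_grad_logE u : B.@[u] != 0 -> neg_grad_log (P, Q) u = rval_at A B u.
Proof.
rewrite mevalM mulf_eq0 negb_or => /andP[Pu Qu]; apply: funext => i.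
by rewrite /neg_grad_log /rval_at /grad /= mevalB !mevalM neg_log_quotient.
Qed.

Lemma image_nglE : image_ngl (P, Q) = rimage A B.
Proof.
apply: funext => p; apply: propext; split=> -[u [Bu ->]].
  by rewrite rdefE in Bu; exists u; rewrite neg_grad_logE.
by exists u; rewrite rdefE neg_grad_logE.
Qed.

Lemma num_den_neq0 : B != 0. Proof. by rewrite mulf_neq0. Qed.

Lemma Phi_neq0 : Phi != 0.
Proof. by rewrite mulf_neq0 ?invr_eq0 ?tofrac_neq0. Qed.

Lemma phi_sym i j : fD i (phi j) = fD j (phi i).
Proof.
exact: (log_gradient_sym (@fDD C n) (@fDM C n) (@fDC C n) (@fD_comm C n) Phi_neq0
  (fD_fraction P0 Q0)).
Qed.

Lemma Phi_at u : B.@[u] != 0 -> evals u Phi (rval (P, Q) u) /\ rval (P, Q) u != 0.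
Proof.
rewrite mevalM mulf_eq0 negb_or => /andP[Pu Qu].
by split; [exact: evals_frac | rewrite mulf_neq0 ?invr_eq0].
Qed.

Variables (d1 d2 : nat).
Hypotheses (hP : homogeneous d1 P) (hQ : homogeneous d2 Q).

Variable F : {mpoly C[n]}.
Hypothesis FP : ev F = Phi.

Lemma phi_orthogonal j :
  \sum_i (ev F^`M(i) / ev F - X i) * fD j (phi i) = 0.
Proof.
exact: (loglik_orthogonal (@fDD C n) (@fDM C n) (@fDC C n) (@fDX C n) Phi_neq0
  (fD_fraction P0 Q0) (ngl_pairing P0 Q0 hP hQ) FP).
Qed.

Lemma F_at u : B.@[u] != 0 -> F.@[rval_at A B u] = rval (P, Q) u.
Proof.
move=> Bu; have [h _] := Phi_at Bu; apply: evals_uniq h.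
by rewrite -FP; apply: evals_mmap; apply: evals_rfrac.
Qed.

Lemma critical_rimage : generic (fun u => B.@[u] != 0 /\ critical F Y u (rval_at A B u)).
Proof.
have := genericI (smooth_rimage A num_den_neq0) (tangent_rimage A num_den_neq0).
apply: generic_imp => u [sm [Bu Tu]]; split; [exact: Bu|split; [exact: sm|]].
split; first by rewrite F_at //; case: (Phi_at Bu).
move=> v /Tu[w wE].
have z : (\row_i grad_loglik F u (rval_at A B u) i) *m rjac_at A B u = 0.
  apply/rowP => j; rewrite [RHS]mxE; apply: (@evals0 _ _ u).
  rewrite -(phi_orthogonal j) mxE; apply: evals_sum => i; apply: evalsM.
    by rewrite mxE; apply: evals_grad_loglik => //; rewrite F_at //; case: (Phi_at Bu).
  by have := evals_rjac A Bu i j; rewrite mxE.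
transitivity (((\row_i grad_loglik F u (rval_at A B u) i) *m (rjac_at A B u *m w)) 0 0).
  by rewrite [RHS]mxE; apply: eq_bigr => i _; rewrite wE [in RHS]mxE.
by rewrite mulmxA z mul0mx mxE.
Qed.

Lemma fiber_translate f u i : vanishing Y f -> B.@[u] != 0 ->
  (A i).@[fun j => u j + f^`M(j).@[rval_at A B u]] =
  rval_at A B u i * B.@[fun j => u j + f^`M(j).@[rval_at A B u]].
Proof.
move=> /(vanishing_rimage _ num_den_neq0) f0 Bu.
have e : mmap (cst C n) (fun j => X j + ev f^`M(j)) (A i) =
    phi i * mmap (cst C n) (fun j => X j + ev f^`M(j)) B.
  apply: (conormal_translation (@fDD C n) (@fDM C n) (@fDC C n) (@fDX C n) phi_sym f0).
  by rewrite !mmap_cst_fX /rfrac divfK ?tofrac_neq0 ?num_den_neq0.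
have ew j : evals u (X j + ev f^`M(j)) (u j + f^`M(j).@[rval_at A B u]).
  apply: evalsD; first by rewrite -[u j]mevalXU; apply: evals_poly.
  by apply: evals_mmap; apply: evals_rfrac.
apply: evals_uniq (evals_mmap (A i) ew) _; rewrite e.
by apply: evalsM; [exact: evals_rfrac | exact: evals_mmap].
Qed.

(* If q is critical for u, then u = grad log F (q) - grad f (q) for some f
   vanishing on Y.  On the image of phi, fibers are conormal spaces, so
   A (grad log F - grad f) = p B (grad log F - grad f) at p = phi(u'); by
   density this holds at q, which reads A(u) = q B(u). *)
Lemma critical_uniq u q : B.@[u] != 0 -> critical F Y u q -> q = rval_at A B u.
Proof.
move=> Bu [[Yq _] [Fq cq]].
have [r [b bY]] := vanishing_basis_ex Y.
have [f [Yf fq]] := conormal_grad bY Yq cq.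
have uE j : u j = (F^`M(j) - F * f^`M(j)).@[q] / F.@[q].
  rewrite mevalB mevalM mulrBl [F.@[q] * _]mulrC mulfK // -fq /grad_loglik /grad.
  by rewrite opprB addrCA subrr addr0.
apply: funext => i; rewrite /rval_at.
have [N [H hH]] := clear_denominators (fun j => F^`M(j) - F * f^`M(j)) F (A i).
have [M [G hG]] := clear_denominators (fun j => F^`M(j) - F * f^`M(j)) F B.
have evW z : (F ^+ M * H - F ^+ N * ('X_i * G)).@[z] =
    F.@[z] ^+ M * H.@[z] - F.@[z] ^+ N * (z i * G.@[z]).
  by rewrite mevalB !mevalM !rmorphXn /= mevalXU.
have YW : vanishing Y (F ^+ M * H - F ^+ N * ('X_i * G)).
  apply/(vanishing_rimage _ num_den_neq0); apply: evals_eq0.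
  apply: generic_imp critical_rimage => u' [Bu' [[Yp _] [Fp cp]]] v.
  move/evals_uniq => /(_ _ (evals_mmap _ (evals_rfrac A Bu'))) ->.
  set p := rval_at A B u' in Yp Fp cp *.
  have [f' [Yf' fp]] := conormal_grad bY Yp cp.
  have Yg : vanishing Y (f' - f) by move=> z Yz; rewrite mevalB Yf' // Yf // subrr.
  have pE : (fun j => u' j + (f' - f)^`M(j).@[p]) =
      fun j => (F^`M(j) - F * f^`M(j)).@[p] / F.@[p].
    apply: funext => j; rewrite mderivB !mevalB -fp /grad_loglik /grad mevalM.
    by rewrite mulrBl [F.@[p] * _]mulrC mulfK // addrA [u' j + _]addrC subrK.
  have := fiber_translate i Yg Bu'; rewrite pE -/p => e.
  rewrite evW (hH _ Fp) (hG _ Fp).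
  exact: (exchange_cancel _ _ e).
have := YW q Yq; rewrite evW (hH _ Fq) (hG _ Fq).
have -> : (fun j => (F^`M(j) - F * f^`M(j)).@[q] / F.@[q]) = u.
  by apply: funext => j; rewrite -uE.
rewrite mulrCA [q i * (_ * _)]mulrCA -!mulrBr => /eqP.
rewrite !mulf_eq0 !expf_eq0 (negbTE Fq) !andbF /= subr_eq0 => /eqP ->.
exact/esym/(mulfK Bu).
Qed.

End GradientMap.

Section Scaling.
Variables (C : numFieldType) (n : nat).
Implicit Types (p : {mpoly C[n]}) (u : 'I_n -> C).

Lemma meval_scale d p t u : (forall m, m \in msupp p -> mdeg m = d) ->
  p.@[fun i => t * u i] = t ^+ d * p.@[u].
Proof.
move=> hp; rewrite !mevalE mulr_sumr !big_seq; apply: eq_bigr => m /hp dm.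
under eq_bigr => i _ do rewrite exprMn.
by rewrite big_split /= prodrXr -mdegE dm mulrCA.
Qed.

Lemma meval_mderiv_scale d p t u i : (forall m, m \in msupp p -> mdeg m = d) ->
  t * p^`M(i).@[fun i => t * u i] = t ^+ d * p^`M(i).@[u].
Proof.
move=> hp; rewrite !mevalE !mulr_sumr !big_seq; apply: eq_bigr => m dm.
under eq_bigr => j _ do rewrite exprMn.
have <- : (mdeg m).+1 = d.
  rewrite -addn1 -(mdeg1 i) -mdegD; apply: hp; move: dm.
  rewrite !mcoeff_msupp mcoeff_deriv; apply: contraNneq => ->; by rewrite mul0rn.
by rewrite big_split /= prodrXr -mdegE exprS -mulrA; congr (_ * _); exact: mulrCA.
Qed.

Lemma meval_line0 p u : (forall t, t != 0 -> p.@[fun i => t * u i] = 0) ->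
  p.@[fun i => 0 * u i] = 0.
Proof.
move=> h; pose q : {poly C} := mmap (@polyC C) (fun i => (u i)%:P * 'X) p.
have qE t : q.[t] = p.@[fun i => t * u i].
  rewrite /q; elim/mpoly_ring_ind: p {h q} => [a|i|a b Ha Hb|a b Ha Hb].
  - by rewrite mmapC hornerC mevalC.
  - by rewrite mmapX mmap1U !hornerE mevalXU mulrC.
  - by rewrite mmapD hornerD Ha Hb mevalD.
  - by rewrite [mmap _ _ _]rmorphM hornerM /= Ha Hb mevalM.
have [q0|q0] := eqVneq q 0; first by rewrite -qE q0 horner0.
have [t] : exists t, (q * 'X).[t] != 0 by apply: poly_nonroot; rewrite mulf_neq0 ?polyX_eq0.
rewrite hornerM hornerX mulf_eq0 negb_or => /andP[qt t0].
by rewrite qE h ?eqxx in qt.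
Qed.

End Scaling.

Section SecondDirection.
Variables (R : realType) (n : nat).
Local Notation C := R[i].
Variables (F P Q : {mpoly C[n]}).
Hypothesis sol : homaloidal_sol F (P, Q).
Local Notation A := (ngl_num P Q).
Local Notation B := (P * Q).
Local Notation Y := (zclosure (image_ngl (P, Q))).

Let P0 : P != 0. Proof. by case: sol => -[]. Qed.
Let Q0 : Q != 0. Proof. by case: sol => -[_ []]. Qed.

Let B0 : B != 0. Proof. exact: mulf_neq0. Qed.

Lemma sol_frac : mmap (cst C n) (rfrac A B) F = P%:F / Q%:F.
Proof.
apply/eqP; rewrite -subr_eq0; apply/eqP/evals_eq0.
have [_] := sol; apply: generic_imp => u [/[dup] du + e] v ev.
rewrite rdefE => Bu; rewrite neg_grad_logE // in e.
apply: evals_uniq ev _; rewrite -[0](subrr (rval (P, Q) u)) {1}e.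
apply: evalsB; first by apply: evals_mmap; apply: evals_rfrac.
by case: (Phi_at Bu).
Qed.

Lemma cone_image : irr_cone Y.
Proof.
have [[_ [_ [[d1 hP] [d2 hQ]]]] _] := sol; split.
  by rewrite image_nglE //; apply: irreducible_rimage.
have stable t p f : t != 0 -> vanishing Y f -> Y p -> f.@[fun i => t * p i] = 0.
  move=> t0 Yf Yp.
  pose g := mmap (@mpolyC n C) (fun i => t%:MP * 'X_i) f.
  have gE z : g.@[z] = f.@[fun i => t * z i].
    rewrite /g /meval mmap_comp; congr (mmap _ _ f); apply: funext => i.
    by rewrite -/(meval _ _) mevalM mevalC mevalXU.
  rewrite -gE; apply: Yp => _ [u [du ->]]; rewrite gE.
  have su (a : {mpoly C[n]}) d : homogeneous d a -> a.@[u] != 0 ->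
      a.@[fun i => t^-1 * u i] != 0 /\
      forall j, t * (a^`M(j).@[u] / a.@[u]) =
        a^`M(j).@[fun i => t^-1 * u i] / a.@[fun i => t^-1 * u i].
    move=> hp pu; have e := meval_scale t^-1 u hp.
    have td : t^-1 ^+ d != 0 by rewrite expf_neq0 ?invr_eq0.
    split=> [|j]; first by rewrite e mulf_neq0.
    have e' := meval_mderiv_scale t^-1 u j hp.
    have -> : a^`M(j).@[fun i => t^-1 * u i] = t * (t^-1 ^+ d * a^`M(j).@[u]).
      by rewrite -e' mulVKf.
    rewrite e invfM -!mulrA; congr (t * _).
    by rewrite [X in _ = _ * X]mulrCA mulVKf.
  move: du; rewrite /rdef /= mulf_eq0 negb_or => /andP[Pu Qu].
  have [Pt PE] := su P d1 hP Pu; have [Qt QE] := su Q d2 hQ Qu.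
  apply: Yf; apply: sub_zclosure; exists (fun i => t^-1 * u i).
  split; first by rewrite /rdef mulf_neq0.
  apply: funext => j; rewrite /neg_grad_log /grad /= -PE -QE.
  by rewrite mulrN mulrBr.
move=> t p Yp f /vanishing_zclosure Yf.
have [->|t0] := eqVneq t 0; last exact: stable.
by apply: meval_line0 => s s0; apply: stable.
Qed.

Lemma critical_image : generic (fun u => rdef (P, Q) u /\
  critical F Y u (neg_grad_log (P, Q) u)).
Proof.
have [[_ [_ [[d1 hP] [d2 hQ]]]] _] := sol.
apply: generic_imp (critical_rimage P0 Q0 hP hQ sol_frac) => u [Bu cu].
by rewrite rdefE neg_grad_logE // image_nglE.
Qed.

Lemma critical_image_uniq u q : rdef (P, Q) u -> critical F Y u q ->
  q = neg_grad_log (P, Q) u.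
Proof.
have [[_ [_ [[d1 hP] [d2 hQ]]]] _] := sol.
rewrite rdefE => Bu; rewrite neg_grad_logE // image_nglE //.
exact: (critical_uniq P0 Q0 hP hQ sol_frac).
Qed.

Lemma solution_to_variety :
  irr_cone Y /\ MLD_one F Y /\
  generic (fun u => rdef (P, Q) u /\ critical F Y u (neg_grad_log (P, Q) u)) /\
  generic (fun u => rdef (P, Q) u /\ forall p, critical F Y u p -> rval (P, Q) u = F.@[p]).
Proof.
split; first exact: cone_image.
split.
  apply: generic_imp critical_image => u [du cu].
  by exists (neg_grad_log (P, Q) u); split=> // q; apply: critical_image_uniq.
split; first exact: critical_image.
have [_ gs] := sol; apply: generic_imp gs => u [du ->]; split=> // p.
by move/(critical_image_uniq du) ->.
Qed.

End SecondDirection.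

(** * Rationality of definable functions *)

Section RationalFunctions.
Variables (C : numClosedFieldType) (n : nat).
Local Notation P := {mpoly C[n]}.
Implicit Types (q r : {poly P}) (u : 'I_n -> C) (t : C).

Definition spec u : {poly P} -> {poly C} := map_poly (meval u).

Lemma specM u q r : spec u (q * r) = spec u q * spec u r.
Proof. exact: rmorphM. Qed.

Lemma specZ u c q t : (spec u (c *: q)).[t] = c.@[u] * (spec u q).[t].
Proof. by rewrite -mul_polyC specM /spec map_polyC hornerM hornerC. Qed.

Lemma lead_spec_neq0 q : q != 0 -> generic (fun u => (lead_coef q).@[u] != 0).
Proof. by move=> q0; apply: generic_nz; rewrite lead_coef_eq0. Qed.

Lemma size_spec u q : (lead_coef q).@[u] != 0 -> size (spec u q) = size q.
Proof. exact: size_poly_eq. Qed.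

Lemma irreducible_factors q : q != 0 -> exists rs : seq {poly P},
  (forall r, r \in rs -> irreducible_poly r) /\
  generic (fun u => forall t, root (spec u q) t -> exists2 r, r \in rs & root (spec u r) t).
Proof.
have [s] := ubnP (size q); elim: s q => // s IH q lts q0.
have [sq|sq] := leqP (size q) 1.
  exists [::]; split=> //; have := lead_spec_neq0 q0.
  rewrite /lead_coef (size1_polyC sq) coefC; case: ifP => _; last first.
    by apply: generic_imp => u; rewrite meval0 eqxx.
  by apply: generic_imp => u h t; rewrite /root /spec map_polyC hornerC (negbTE h).
have [irr|red] := pselect (irreducible_poly q).
  exists [:: q]; split=> [r|]; first by rewrite inE => /eqP->.
  by apply: genericT => u t rt; exists q; rewrite ?inE.
have [a [sa aq nE]] : exists a : {poly P}, [/\ size a != 1, a %| q & ~~ (a %= q)].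
  apply: contrapT => no; apply: red; split=> // a sa aq.
  by apply: contrapT => nE; apply: no; exists a; split=> //; apply/negP.
have /Pdiv.WeakIdomain.dvdpP[[c b] /= c0 e] := aq.
have cq0 : c *: q != 0 by rewrite -mul_polyC mulf_neq0 ?polyC_eq0.
have a0 : a != 0 by apply: contraNneq cq0 => a0; rewrite e a0 mulr0.
have b0 : b != 0 by apply: contraNneq cq0 => b0; rewrite e b0 mul0r.
have lta : (size a < size q)%N.
  rewrite ltn_neqAle dvdp_leq // andbT; apply: contra nE => /eqP h.
  by rewrite -dvdp_size_eqp // h.
have ltb : (size b < size q)%N.
  have := size_mul b0 a0; rewrite -e size_scale // => ->.
  have : (1 < size a)%N by rewrite ltn_neqAle eq_sym sa size_poly_gt0.
  by case: (size a) => [|[|k]] // _; rewrite addnS /= addnS ltnS leq_addr.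
have [ra [ia ga]] := IH a (leq_trans lta lts) a0.
have [rb [ib gb]] := IH b (leq_trans ltb lts) b0.
exists (ra ++ rb); split=> [r|]; first by rewrite mem_cat => /orP[/ia|/ib].
apply: generic_imp (genericI (generic_nz c0) (genericI ga gb)) => u [cu [au bu]] t rt.
have : root (spec u b * spec u a) t.
  by rewrite -specM -e /root specZ (rootP rt) mulr0.
rewrite rootM => /orP[/bu|/au] [r rr rtr]; exists r => //; by rewrite mem_cat rr ?orbT.
Qed.

Lemma coprime_spec q r : coprimep q r ->
  generic (fun u => forall t, root (spec u q) t -> ~~ root (spec u r) t).
Proof.
case/Bezout_coprimepP => -[a b] /= /eqpP[[c1 c2] /= /andP[c10 c20] e].
apply: generic_imp (generic_nz c20) => u c2u t qt; apply: contraNN c2u => rt.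
have := congr1 (fun q => (spec u q).[t]) e.
rewrite !specZ /spec rmorphD rmorphM rmorphM /= rmorph1 hornerD !hornerM hornerC.
by rewrite (rootP qt) (rootP rt) !mulr0 addr0 mulr0 mulr1 => <-.
Qed.

Lemma irreducible_root_dichotomy r q : irreducible_poly r ->
  generic (fun u => forall t, root (spec u r) t -> root (spec u q) t = (r %| q)).
Proof.
move=> irr; have [rq|rq] := boolP (r %| q).
  have /Pdiv.WeakIdomain.dvdpP[[c b] /= c0 e] := rq.
  apply: generic_imp (generic_nz c0) => u cu t rt.
  have := specZ u c q t; rewrite e specM hornerM (rootP rt) mulr0.
  by move/esym/eqP; rewrite mulf_eq0 (negbTE cu).
have cop : coprimep r q.
  rewrite coprimep_def; apply: contraNT rq => sg.
  by have := irr.2 _ sg (dvdp_gcdl r q) => /eqp_dvdl <-; exact: dvdp_gcdr.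
by apply: generic_imp (coprime_spec cop) => u h t /h/negbTE.
Qed.

Lemma irreducible_simple_roots r : irreducible_poly r ->
  generic (fun u => forall t, root (spec u r) t -> ~~ root (spec u r^`()) t).
Proof.
move=> irr; have r0 := irredp_neq0 irr.
have ndiv : ~~ (r %| r^`()).
  apply/negP => /(dvdp_leq (deriv_mpoly_neq0 irr.1)).
  by rewrite leqNgt lt_size_deriv.
apply: generic_imp (irreducible_root_dichotomy r^`() irr) => u h t /h ->.
exact: ndiv.
Qed.

(* A relation between u and t which only depends on the vanishing of finitely
   many polynomials and which is generically the graph of a function is the
   graph of a rational function: it holds at all roots of some irreducible
   polynomial over C(u), whose degree must then be 1. *)
Lemma rational_of_atoms (qs : seq {poly P}) (G : ('I_n -> C) -> C -> Prop) :
  (forall u t u' t', (forall q, q \in qs -> root (spec u q) t = root (spec u' q) t') ->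
     G u t -> G u' t') ->
  generic (fun u => exists t, G u t /\ forall t', G u t' -> t' = t) ->
  exists a b, b != 0 /\ generic (fun u => b.@[u] != 0 /\ G u (a.@[u] / b.@[u])).
Proof.
move=> det uni.
pose Q := \prod_(q <- qs | q != 0) q.
have Q0 : Q != 0 by rewrite /Q; elim/big_ind: _ => [|x y|//]; [exact: oner_neq0|exact: mulf_neq0].
have [rs [irr grs]] := irreducible_factors Q0.
have gl : generic (fun u => forall r, r \in rs -> (lead_coef r).@[u] != 0).
  by apply: generic_seq => r /irr/irredp_neq0/lead_spec_neq0.
have gd : generic (fun u => forall r, r \in rs -> forall q, q \in qs ->
    forall t, root (spec u r) t -> root (spec u q) t = (r %| q)).
  apply: generic_seq => r /irr ir; apply: generic_seq => q _.
  exact: irreducible_root_dichotomy.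
have gs : generic (fun u => forall r, r \in rs ->
    forall t, root (spec u r) t -> ~~ root (spec u r^`()) t).
  by apply: generic_seq => r /irr/irreducible_simple_roots.
have gen := genericI uni (genericI gl (genericI gd gs)).
have [u0 [[[t0 [Gt0 u0uni]] [u0l [u0d u0s]]] [u0Q u0r]]] :=
  generic_ex (genericI gen (genericI (lead_spec_neq0 Q0) grs)).
have Qroot : root (spec u0 Q) t0.
  apply/negPn/negP => nr.
  have sQ : spec u0 Q * ('X - t0%:P) != 0.
    by rewrite mulf_neq0 ?polyXsubC_eq0 // -size_poly_gt0 size_spec // size_poly_gt0.
  have [t1] := poly_nonroot sQ; rewrite hornerM hornerXsubC mulf_eq0 negb_or subr_eq0.
  move=> /andP[nr1 /eqP]; apply; apply: u0uni; apply: det Gt0 => q qqs.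
  have [->|q0] := eqVneq q 0; first by rewrite /spec rmorph0 !root0.
  have nroot t : ~~ root (spec u0 Q) t -> root (spec u0 q) t = false.
    move=> h; apply: contraNF h; rewrite /Q (big_rem q) //= q0 specM rootM.
    by move=> ->.
  by rewrite !nroot.
have [r rrs rt0] := u0r t0 Qroot.
have Groot u t : (forall q, q \in qs ->
    forall t, root (spec u r) t -> root (spec u q) t = (r %| q)) ->
    root (spec u r) t -> G u t.
  move=> h rt; apply: det Gt0 => q qqs.
  by rewrite (u0d r rrs q qqs t0 rt0) (h q qqs t rt).
have sr : size r = 2.
  apply/eqP; rewrite eqn_leq (irr r rrs).1 andbT leqNgt; apply/negP => lt.
  have /factor_theorem[s sE] := rt0.
  have ss : size s != 1.
    have := size_spec (u0l r rrs); rewrite sE size_Mmonic ?monicXsubC //; last first.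
      apply: contraTneq lt => s0; rewrite -(size_spec (u0l r rrs)) sE s0 mul0r.
      by rewrite size_poly0.
    by rewrite size_XsubC addn2 /= => e; rewrite -eqSS e neq_ltn lt orbT.
  have [t1 st1] := closed_rootP _ ss.
  have t1E : t1 = t0.
    apply: u0uni; apply: Groot (u0d r rrs) _.
    by rewrite sE rootM st1.
  have := u0s r rrs t0 rt0; rewrite /spec -deriv_map -/(spec u0 r) sE derivM.
  rewrite /root hornerD !hornerM derivXsubC hornerC hornerXsubC subrr mulr0 add0r mulr1.
  by rewrite -t1E (rootP st1) eqxx.
exists (- r`_0), r`_1; have r1 : r`_1 = lead_coef r by rewrite lead_coefE sr.
have r10 : r`_1 != 0 by rewrite r1 lead_coef_eq0 irredp_neq0 //; apply: irr.
split=> //; apply: generic_imp gen => u [_ [ul [ud _]]].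
have ru : (r`_1).@[u] != 0 by rewrite r1; apply: ul.
split=> //; apply: Groot (ud r rrs) _.
rewrite /root horner_coef size_spec ?ul // sr big_ord_recl big_ord1 /= expr0 mulr1 expr1.
by rewrite /spec !coef_map /= mevalN mulrCA divff // mulr1 subrr.
Qed.

End RationalFunctions.

Lemma enum_sum (I J : finType) : enum {: I + J} = map inl (enum I) ++ map inr (enum J).
Proof. by rewrite !enumT [in LHS]unlock. Qed.

Section Definable.
Variable C : closedFieldType.
Local Notation term := (GRing.term C).
Local Notation formula := (GRing.formula C).

Definition env (I : finType) (e : I -> C) : seq C := [seq e i | i <- enum I].

Definition join (I J : Type) (e : I -> C) (b : J -> C) (x : I + J) : C :=
  match x with inl i => e i | inr j => b j end.

Lemma env_join (I J : finType) (e : I -> C) (b : J -> C) :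
  env (join e b) = env e ++ env b.
Proof. by rewrite /env enum_sum map_cat -!map_comp. Qed.

Definition poly_fun (I : finType) (h : (I -> C) -> C) :=
  exists t : term, GRing.rterm t /\ forall e, GRing.eval (env e) t = h e.

Definition definable (I : finType) (P : (I -> C) -> Prop) :=
  exists f : formula, GRing.rformula f /\ forall e, GRing.holds (env e) f <-> P e.

Section Closure.
Variable I : finType.
Implicit Types (h : (I -> C) -> C) (P Q : (I -> C) -> Prop).

Lemma poly_fun_var i : poly_fun (fun e : I -> C => e i).
Proof.
exists (GRing.Var _ (enum_rank i)); split=> // e /=.
by rewrite /env (nth_map i) -?cardE ?ltn_ord // nth_enum_rank.
Qed.

Lemma poly_fun_const c : poly_fun (fun _ : I -> C => c).
Proof. by exists (GRing.Const c). Qed.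

Lemma poly_funD h1 h2 : poly_fun h1 -> poly_fun h2 -> poly_fun (fun e => h1 e + h2 e).
Proof.
move=> [t1 [r1 e1]] [t2 [r2 e2]]; exists (GRing.Add t1 t2); rewrite /= r1 r2.
by split=> // e; rewrite e1 e2.
Qed.

Lemma poly_funM h1 h2 : poly_fun h1 -> poly_fun h2 -> poly_fun (fun e => h1 e * h2 e).
Proof.
move=> [t1 [r1 e1]] [t2 [r2 e2]]; exists (GRing.Mul t1 t2); rewrite /= r1 r2.
by split=> // e; rewrite e1 e2.
Qed.

Lemma poly_funN h : poly_fun h -> poly_fun (fun e => - h e).
Proof. by move=> [t [r et]]; exists (GRing.Opp t); split=> //= e; rewrite et. Qed.

Lemma poly_funB h1 h2 : poly_fun h1 -> poly_fun h2 -> poly_fun (fun e => h1 e - h2 e).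
Proof. by move=> p1 p2; apply: poly_funD => //; apply: poly_funN. Qed.

Lemma poly_fun_sum (J : Type) (r : seq J) (h : J -> (I -> C) -> C) :
  (forall j, poly_fun (h j)) -> poly_fun (fun e => \sum_(j <- r) h j e).
Proof.
move=> ph; elim: r => [|j r [t [rt et]]].
  by exists (GRing.Const 0); split=> // e; rewrite big_nil.
have [t' [rt' et']] := ph j; exists (GRing.Add t' t); rewrite /= rt rt'.
by split=> // e; rewrite et et' big_cons.
Qed.

Lemma definable_ext P Q : (forall e, P e <-> Q e) -> definable P -> definable Q.
Proof. by move=> PQ [f [rf fP]]; exists f; split=> // e; rewrite fP. Qed.

Lemma definable_eq0 h : poly_fun h -> definable (fun e => h e = 0).
Proof.
move=> [t [rt et]]; exists (GRing.Equal t (GRing.Const 0)); split=> [|e /=].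
  by rewrite /= rt.
by rewrite et.
Qed.

Lemma definable_and P Q : definable P -> definable Q -> definable (fun e => P e /\ Q e).
Proof.
move=> [f [rf fP]] [g [rg gQ]]; exists (GRing.And f g); rewrite /= rf rg.
by split=> // e; rewrite fP gQ.
Qed.

Lemma definable_imp P Q : definable P -> definable Q -> definable (fun e => P e -> Q e).
Proof.
move=> [f [rf fP]] [g [rg gQ]]; exists (GRing.Implies f g); rewrite /= rf rg.
by split=> // e; rewrite fP gQ.
Qed.

Lemma definable_not P : definable P -> definable (fun e => ~ P e).
Proof.
move=> [f [rf fP]]; exists (GRing.Not f); split=> // e /=.
by rewrite fP.
Qed.

Lemma definable_fin (J : finType) (P : J -> (I -> C) -> Prop) :
  (forall j, definable (P j)) -> definable (fun e => forall j, P j e).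
Proof.
move=> dP; suff [f [rf fP]] : definable (fun e => forall j, j \in enum J -> P j e).
  exists f; split=> // e; rewrite fP; split=> h j; last by move=> _; apply: h.
  by apply: h; rewrite mem_enum.
elim: (enum J) => [|j s [f [rf fP]]]; first by exists (GRing.Bool true).
have [g [rg gP]] := dP j; exists (GRing.And g f); rewrite /= rf rg; split=> // e /=.
rewrite gP fP; split=> [[hj hs] l|h].
  by rewrite inE => /orP[/eqP->|/hs].
by split=> [|l ls]; apply: h; rewrite inE ?eqxx ?ls ?orbT.
Qed.

End Closure.

Lemma holds_exists_block (f : formula) k (s : seq C) :
  GRing.holds s (foldr (@GRing.Exists C) f (iota (size s) k)) <->
  exists b, size b = k /\ GRing.holds (s ++ b) f.
Proof.
elim: k s => [|k IH] s /=.
  split=> [h|[b [/size0nil -> ]]]; last by rewrite cats0.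
  by exists [::]; rewrite cats0.
have setE x : set_nth 0 s (size s) x = rcons s x.
  by elim: s {IH} => //= y s ->.
split=> [[x]|[b [sb h]]].
  rewrite setE -(size_rcons s x) => /IH[b [sb h]]; exists (x :: b).
  by rewrite /= sb; split=> //; rewrite -cat_rcons.
case: b sb h => // x b [sb] h.
exists x; rewrite setE -(size_rcons s x); apply/IH; exists b; split=> //.
by rewrite cat_rcons.
Qed.

Lemma definable_ex (I J : finType) (P : (I + J -> C) -> Prop) :
  definable P -> definable (fun e : I -> C => exists b : J -> C, P (join e b)).
Proof.
move=> [f [rf fP]]; exists (foldr (@GRing.Exists C) f (iota #|I| #|J|)); split.
  by elim: (iota _ _).
move=> e; have <- : size (env e) = #|I| by rewrite size_map -cardE.
rewrite holds_exists_block; split=> [[s [ss h]]|[b Pb]]; last first.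
  exists (env b); split; first by rewrite size_map -cardE.
  by rewrite -env_join fP.
pose b (j : J) := nth 0 s (enum_rank j).
have sE : env b = s.
  apply: (@eq_from_nth _ 0); rewrite size_map -cardE // => i iJ.
  have j0 : J by have := enum_val (Ordinal iJ).
  rewrite (nth_map j0) -?cardE // /b -[in RHS](_ : enum_rank (nth j0 (enum J) i) = i :> nat) //.
  have -> : nth j0 (enum J) i = enum_val (Ordinal iJ) by rewrite (enum_val_nth j0).
  by rewrite enum_valK.
by exists b; rewrite -fP env_join sE.
Qed.

Lemma definable_all (I J : finType) (P : (I + J -> C) -> Prop) :
  definable P -> definable (fun e : I -> C => forall b : J -> C, P (join e b)).
Proof.
move=> dP.
have := definable_not (definable_ex (definable_not dP)); apply: definable_ext => e; split.
  by move=> h b; apply: contrapT => nP; apply: h; exists b.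
by move=> h [b]; apply.
Qed.

End Definable.

Lemma poly_fun_meval (C : numClosedFieldType) (I : finType) m (p : {mpoly C[m]})
  (h : 'I_m -> (I -> C) -> C) :
  (forall i, poly_fun (h i)) -> poly_fun (fun e => p.@[fun i => h i e]).
Proof.
move=> ph; elim/mpoly_ring_ind: p => [c|i|p q [t [rt et]] [t' [rt' et']]|p q [t [rt et]] [t' [rt' et']]].
- by exists (GRing.Const c); split=> // e; rewrite mevalC.
- by have [t [rt et]] := ph i; exists t; split=> // e; rewrite mevalXU.
- by exists (GRing.Add t t'); rewrite /= rt rt'; split=> // e; rewrite et et' mevalD.
- by exists (GRing.Mul t t'); rewrite /= rt rt'; split=> // e; rewrite et et' mevalM.
Qed.

Section Atoms.
Variables (C : numClosedFieldType) (n : nat).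
Local Notation P := {mpoly C[n]}.

Definition env1 (u : 'I_n -> C) (t : C) : seq C := env u ++ [:: t].

Lemma term_atom (t : GRing.term C) : GRing.rterm t ->
  exists q : {poly P}, forall u x, GRing.eval (env1 u x) t = (spec u q).[x].
Proof.
elim: t => //= [i _|c _|m _|t1 IH1 t2 IH2 /andP[/IH1[q1 h1] /IH2[q2 h2]]|t IH /IH[q h]|
  t IH m /IH[q h]|t1 IH1 t2 IH2 /andP[/IH1[q1 h1] /IH2[q2 h2]]|t IH m /IH[q h]].
- have [lt|] := ltnP i n.
    exists ('X_(Ordinal lt))%:P => u x.
    rewrite /env1 nth_cat size_map size_enum_ord lt (nth_map (Ordinal lt)) ?size_enum_ord //.
    rewrite /spec map_polyC hornerC /= mevalXU; congr u; apply/val_inj.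
    by rewrite /= nth_enum_ord.
  rewrite leq_eqVlt => /orP[/eqP e|gt].
    exists 'X => u x; rewrite /env1 nth_cat size_map size_enum_ord -e ltnn subnn.
    by rewrite /spec map_polyX hornerX.
  exists 0 => u x; rewrite nth_default; first by rewrite /spec rmorph0 horner0.
  by rewrite /env1 size_cat size_map size_enum_ord addn1.
- by exists (c%:MP)%:P => u x; rewrite /spec map_polyC hornerC /= mevalC.
- by exists m%:R => u x; rewrite /spec rmorph_nat hornerMn hornerC.
- by exists (q1 + q2) => u x; rewrite h1 h2 /spec rmorphD hornerD.
- by exists (- q) => u x; rewrite h /spec rmorphN hornerN.
- by exists (q *+ m) => u x; rewrite h /spec rmorphMn hornerMn.
- by exists (q1 * q2) => u x; rewrite h1 h2 /spec rmorphM hornerM.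
- by exists (q ^+ m) => u x; rewrite h /spec rmorphXn horner_exp.
Qed.

Lemma formula_atoms (f : GRing.formula C) : GRing.qf_form f && GRing.rformula f ->
  exists qs : seq {poly P}, forall u x u' x',
    (forall q, q \in qs -> root (spec u q) x = root (spec u' q) x') ->
    GRing.qf_eval (env1 u x) f = GRing.qf_eval (env1 u' x') f.
Proof.
have two (f1 f2 : GRing.formula C) (op : bool -> bool -> bool) (qs1 qs2 : seq {poly P}) :
  (forall u x u' x', (forall q, q \in qs1 -> root (spec u q) x = root (spec u' q) x') ->
    GRing.qf_eval (env1 u x) f1 = GRing.qf_eval (env1 u' x') f1) ->
  (forall u x u' x', (forall q, q \in qs2 -> root (spec u q) x = root (spec u' q) x') ->
    GRing.qf_eval (env1 u x) f2 = GRing.qf_eval (env1 u' x') f2) ->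
  forall u x u' x',
    (forall q, q \in qs1 ++ qs2 -> root (spec u q) x = root (spec u' q) x') ->
    op (GRing.qf_eval (env1 u x) f1) (GRing.qf_eval (env1 u x) f2) =
    op (GRing.qf_eval (env1 u' x') f1) (GRing.qf_eval (env1 u' x') f2).
  move=> h1 h2 u x u' x' h; congr op.
    by apply: h1 => q qs; apply: h; rewrite mem_cat qs.
  by apply: h2 => q qs; apply: h; rewrite mem_cat qs orbT.
elim: f => //= [b _|t1 t2 /andP[/term_atom[q1 h1] /term_atom[q2 h2]]|f1 IH1 f2 IH2|
  f1 IH1 f2 IH2|f1 IH1 f2 IH2|f IH /IH //].
- by exists [::].
- exists [:: q1 - q2] => u x u' x' /(_ (q1 - q2)); rewrite inE eqxx => /(_ isT).
  rewrite /root !h1 !h2 /spec !rmorphB !hornerD !hornerN !subr_eq0.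
  by [].
- rewrite andbACA => /andP[/IH1[qs1 h1] /IH2[qs2 h2]]; exists (qs1 ++ qs2).
  exact: (two _ _ andb _ _ h1 h2).
- rewrite andbACA => /andP[/IH1[qs1 h1] /IH2[qs2 h2]]; exists (qs1 ++ qs2).
  exact: (two _ _ orb _ _ h1 h2).
- rewrite andbACA => /andP[/IH1[qs1 h1] /IH2[qs2 h2]]; exists (qs1 ++ qs2).
  exact: (two _ _ implb _ _ h1 h2).
- case=> qs h; exists qs => u x u' x' e; by rewrite (h _ _ _ _ e).
Qed.

Lemma env1E (u : 'I_n -> C) t : env (join u (fun _ : unit => t)) = env1 u t.
Proof.
rewrite env_join; congr (_ ++ _); rewrite /env.
by have -> : enum (@predT unit) = [:: tt] by rewrite enumT unlock.
Qed.

Lemma definable_function_rational (G : ('I_n -> C) -> C -> Prop) :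
  definable (fun e : 'I_n + unit -> C => G (fun i => e (inl i)) (e (inr tt))) ->
  generic (fun u => exists t, G u t /\ forall t', G u t' -> t' = t) ->
  exists a b : P, b != 0 /\ generic (fun u => b.@[u] != 0 /\ G u (a.@[u] / b.@[u])).
Proof.
move=> [f [rf fG]].
pose g := GRing.quantifier_elim (@ClosedFieldQE.ex_elim C) f.
have wf := GRing.quantifier_elim_wf (@ClosedFieldQE.wf_ex_elim C) rf.
have gG u t : G u t <-> GRing.qf_eval (env1 u t) g.
  have := fG (join u (fun=> t)); rewrite env1E /= => <-.
  have /(_ (env1 u t)) := GRing.quantifier_elim_rformP (@ClosedFieldQE.wf_ex_elim C)
    (@ClosedFieldQE.holds_ex_elim C (@solve_monicpoly C)) _ rf.
  by case; split.
have [qs qsP] := formula_atoms wf.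
apply: rational_of_atoms (qs) _ _ => u t u' t' h; rewrite !gG.
by rewrite (qsP _ _ _ _ h).
Qed.

End Atoms.

(** * Varieties of maximum likelihood degree one *)

Section Conormal.
Variables (C : numFieldType) (K : fieldType) (io : {rmorphism C -> K}) (n r : nat).
Variables (D : 'I_n -> K -> K) (X phi : 'I_n -> K).
Hypothesis DD : forall j x y, D j (x + y) = D j x + D j y.
Hypothesis DM : forall j x y, D j (x * y) = D j x * y + x * D j y.
Hypothesis DC : forall j c, D j (io c) = 0.
Hypothesis DX : forall i j, D j (X i) = (i == j)%:R.
Variables (F : {mpoly C[n]}) (b : 'I_r -> {mpoly C[n]}) (c : 'I_r -> K).
Local Notation ev := (mmap io phi).
Hypothesis F0 : ev F != 0.
Hypothesis b0 : forall a, ev (b a) = 0.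
Hypothesis conormal : forall i,
  ev F^`M(i) / ev F - X i = \sum_a c a * ev (b a)^`M(i).

Let D_sum j (I : Type) (s : seq I) (x : I -> K) :
  D j (\sum_(i <- s) x i) = \sum_(i <- s) D j (x i).
Proof. exact: (big_morph (D j) (DD j) (derivation0 (DC j))). Qed.

Let D_ev j G : D j (ev G) = \sum_i ev G^`M(i) * D j (phi i).
Proof. exact: (chain_rule (DD j) (DM j) (DC j)). Qed.

Lemma D_quotient j x y : y != 0 -> D j (x / y) = (D j x - x / y * D j y) / y.
Proof.
move=> y0; apply: (mulIf y0); rewrite divfK //.
by have := DM j (x / y) y; rewrite divfK // => ->; rewrite addrK.
Qed.

Let DN j x : D j (- x) = - D j x.
Proof. by apply/eqP; rewrite -addr_eq0 -DD addNr (derivation0 (DC j)). Qed.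

(* Differentiating u = grad log F (phi u) - \sum_a c_a grad b_a (phi u) writes
   the identity matrix as a sum of a matrix factoring through the differential
   of phi and of one factoring through the conormal space. *)
Lemma conormal_rank :
  (n <= \rank (jac D phi) + \rank (\matrix_(a, i) ev (b a)^`M(i)))%N.
Proof.
set M := jac D phi; set J := \matrix_(a, i) _.
pose S := \matrix_(i, l) ((ev F^`M(i)^`M(l) - ev F^`M(i) / ev F * ev F^`M(l)) / ev F -
  \sum_a c a * ev (b a)^`M(i)^`M(l)) : 'M[K]_n.
pose N := \matrix_(a, j) D j (c a) : 'M[K]_(r, n).
have e : 1%:M = S *m M - J^T *m N.
  apply/matrixP => i j; have := congr1 (D j) (conormal i).
  rewrite DD DN DX D_quotient // !D_ev D_sum => /(canRL (subKr _)) deltaE.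
  rewrite [LHS]mxE deltaE.
  under [X in _ - X]eq_bigr do rewrite DM D_ev.
  rewrite big_split /= opprD addrA addrAC !mxE; congr (_ - _); last first.
    by apply: eq_bigr => a _; rewrite !mxE mulrC.
  rewrite mulr_sumr -sumrB mulr_suml.
  under [X in _ - X]eq_bigr do rewrite mulr_sumr.
  rewrite exchange_big -sumrB /=; apply: eq_bigr => l _; rewrite !mxE.
  rewrite mulrA -mulrBl mulrAC [RHS]mulrBl; congr (_ - _).
  by rewrite mulr_suml; apply: eq_bigr => a _; rewrite mulrA.
rewrite -{1}(mxrank1 K n) e; apply: leq_trans (mxrank_add _ _) _.
rewrite mxrank_opp; apply: leq_add; first exact: mxrankM_maxr.
by rewrite -(mxrank_tr J); apply: mxrankM_maxl.
Qed.

Lemma conormal_tangent j :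
  \sum_i (ev F^`M(i) / ev F - X i) * D j (phi i) = 0.
Proof.
under eq_bigr => i _ do rewrite conormal mulr_suml.
rewrite exchange_big big1 //= => a _.
under eq_bigr do rewrite -mulrA.
by rewrite -mulr_sumr -D_ev b0 (derivation0 (DC j)) mulr0.
Qed.

Hypothesis cone : forall a, \sum_i ev (b a)^`M(i) * phi i = 0.
Variable d : C.
Hypothesis euler_F : \sum_i ev F^`M(i) * phi i = io d * ev F.

Lemma conormal_pairing : \sum_i X i * phi i = io d.
Proof.
have : \sum_i (ev F^`M(i) / ev F - X i) * phi i = 0.
  under eq_bigr => i _ do rewrite conormal mulr_suml.
  rewrite exchange_big big1 //= => a _.
  under eq_bigr do rewrite -mulrA.
  by rewrite -mulr_sumr cone mulr0.
under eq_bigr do rewrite mulrBl mulrAC.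
by rewrite sumrB -mulr_suml euler_F mulfK // => /eqP; rewrite subr_eq0 => /eqP.
Qed.

Lemma conormal_logderiv j : D j (ev F) = - ev F * phi j.
Proof.
have := conormal_tangent j; under eq_bigr do rewrite mulrBl.
rewrite sumrB (log_gradient_pairing DD DM DC DX conormal_pairing) opprK.
under eq_bigr do rewrite mulrAC.
rewrite -mulr_suml -D_ev => /eqP; rewrite addr_eq0 => /eqP e.
by rewrite -(divfK F0 (D j (ev F))) e !mulNr mulrC.
Qed.

End Conormal.

Lemma clear_square_denominator (K : fieldType) (x t a b : K) : b != 0 ->
  x / b ^+ 2 = - t * (a / b) -> x = - (t * (a * b)).
Proof.
move=> b0 h; rewrite -(divfK (expf_neq0 2 b0) x) h.
by field.
Qed.

Section HomogeneousQuotient.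
Variables (C : numFieldType) (n : nat).
Local Notation P := {mpoly C[n]}.
Local Notation K := {fraction P}.
Variables (Phi : K) (d : nat).
Hypothesis Phi0 : Phi != 0.
Hypothesis eulerPhi : \sum_j fX C j * fD j Phi = - cst C n d%:R * Phi.

Lemma euler_quotient a b : b != 0 -> Phi = a%:F / b%:F ->
  euler a * b - a * euler b = - (d%:R%:MP * (a * b)).
Proof.
move=> b0 e; have := eulerPhi; rewrite e.
under eq_bigr do rewrite fD_frac // mulrA.
rewrite -mulr_suml => /(clear_square_denominator (tofrac_neq0 b0)) h.
apply/eqP; rewrite -tofrac_eq tofracN tofracM tofracM -cstE -h; apply/eqP.
rewrite /euler mulr_sumr mulr_suml -sumrB raddf_sum /=; apply: eq_bigr => j _.
rewrite tofracB !tofracM mulrBr; congr (_ - _); last exact: mulrCA.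
by rewrite mulrA.
Qed.

(* With E the Euler operator and l the degree of b, passing from (a, b) to
   (E a - (l - d) a, E b - l b) keeps the quotient and removes the part of
   degree l of b. *)
Lemma homogeneous_quotient : exists a b, [/\ a != 0, b != 0, Phi = a%:F / b%:F &
  (exists d1, forall m, m \in msupp a -> mdeg m = d1) /\
  (exists d2, forall m, m \in msupp b -> mdeg m = d2)].
Proof.
suff h a b : b != 0 -> Phi = a%:F / b%:F -> exists a b, [/\ a != 0, b != 0, Phi = a%:F / b%:F &
    (exists d1, forall m, m \in msupp a -> mdeg m = d1) /\
    (exists d2, forall m, m \in msupp b -> mdeg m = d2)].
  exact: h (denf_neq0 Phi) (numden Phi).
have [s] := ubnP (msize b); elim: s a b => // s IH a b lts b0 e.
have a0 : a != 0 by apply: contraNneq Phi0 => a0; rewrite e a0 tofrac0 mul0r.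
pose l := (msize b).-1; have lE : msize b = l.+1.
  by rewrite /l prednK // lt0n msize_poly_eq0.
pose b1 := euler b - l%:R%:MP * b; pose a1 := euler a - (l%:R - d%:R)%:MP * a.
have rel : a1 * b = a * b1.
  have /eqP := euler_quotient b0 e; rewrite subr_eq => /eqP h.
  rewrite /a1 /b1 mulrBl h mpolyCB; ring.
have cb1 m : b1@_m = ((mdeg m)%:R - l%:R) * b@_m.
  by rewrite /b1 mcoeffB mcoeff_euler mcoeffCM mulrBl.
have [b10|b10] := eqVneq b1 0.
  have a10 : a1 = 0.
    by apply/eqP; have /eqP := rel; rewrite b10 mulr0 mulf_eq0 (negbTE b0) orbF.
  exists a, b; split=> //; split.
    exists (mdeg (mlead a)) => m.
    have deg m' : m' \in msupp a -> (mdeg m')%:R = l%:R - d%:R :> C.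
      rewrite mcoeff_msupp => am; have := congr1 (mcoeff m') a10.
      rewrite /a1 mcoeffB mcoeff_euler mcoeffCM mcoeff0 -mulrBl => /eqP.
      by rewrite mulf_eq0 (negbTE am) orbF subr_eq0 => /eqP.
    move=> /deg e1; have e2 := deg _ (mlead_supp a0).
    by apply/eqP; rewrite -(eqr_nat C) e1 e2.
  exists l => m; rewrite mcoeff_msupp => bm; have := cb1 m; rewrite b10 mcoeff0 => /esym/eqP.
  by rewrite mulf_eq0 (negbTE bm) orbF subr_eq0 eqr_nat => /eqP.
apply: (IH a1 b1) => //; last first.
  by rewrite e; apply/eqP; rewrite fracE_eq // -rel.
rewrite -(mlead_deg b10); have := mlead_supp b10; rewrite mcoeff_msupp cb1 mulf_eq0 negb_or.
rewrite subr_eq0 eqr_nat -mcoeff_msupp => /andP[nl /msize_mdeg_lt].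
rewrite lE ltnS leq_eqVlt (negbTE nl) /= => lt.
by move: lts; rewrite lE ltnS; apply: leq_trans; rewrite ltnS.
Qed.

End HomogeneousQuotient.

Lemma has_indep_inverse (R : realType) n k (W : ('I_n -> R[i]) -> Prop) :
  has_indep k W <-> exists b : ('I_k * 'I_n) + ('I_n * 'I_k) -> R[i],
    (forall ij : 'I_k * 'I_k,
      \sum_l b (inl (ij.1, l)) * b (inr (l, ij.2)) - (ij.1 == ij.2)%:R = 0) /\
    forall j, W (fun i => b (inl (j, i))).
Proof.
split=> [[A [rA AW]]|[b [bE bW]]].
  have /row_freeP[B AB] : row_free A by rewrite /row_free rA.
  exists (fun x => match x with inl (j, i) => A j i | inr (i, j) => B i j end).
  split=> [[i j] /=|j]; last exact: AW.
  by have /matrixP/(_ i j) := AB; rewrite !mxE => ->; rewrite subrr.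
exists (\matrix_(j, i) b (inl (j, i))); split; last first.
  by move=> j; have := bW j; congr W; apply: funext => i; rewrite mxE.
apply/eqP/row_freeP; exists (\matrix_(i, j) b (inr (i, j))).
apply/matrixP => i j; rewrite !mxE; have /= /eqP := bE (i, j).
by rewrite subr_eq0 => /eqP <-; apply: eq_bigr => l _; rewrite !mxE.
Qed.

Section RationalMLE.
Variables (R : realType) (n : nat).
Local Notation C := R[i].
Variables (F : {mpoly C[n]}) (Y : ('I_n -> C) -> Prop).
Variables (r : nat) (b : 'I_r -> {mpoly C[n]}).
Hypothesis bY : vanishing_basis Y b.
Hypothesis cY : zclosed Y.
Variable e : nat.
Hypothesis dimY : var_dim Y e.

Let Tb (p v : 'I_n -> C) := forall a, \sum_i (b a)^`M(i).@[p] * v i = 0.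

Lemma criticalE u p : critical F Y u p <->
  (forall a, (b a).@[p] = 0) /\ has_indep e (Tb p) /\ ~ has_indep e.+1 (Tb p) /\
  ~ F.@[p] = 0 /\
  forall v, Tb p v -> \sum_i (F^`M(i).@[p] - F.@[p] * u i) * v i = 0.
Proof.
have TE : Y p -> tangent_space Y p = Tb p.
  move=> Yp; apply: funext => v; apply: propext; rewrite (tangent_grads bY) //.
  split=> [h a|h]; first by have := grads_mulE b p v a; rewrite h mxE => /esym.
  by apply/colP => a; rewrite grads_mulE mxE; apply: h.
have crit v : F.@[p] != 0 -> (pairing (grad_loglik F u p) v = 0) <->
    (\sum_i (F^`M(i).@[p] - F.@[p] * u i) * v i = 0).
  move=> Fp; have -> : \sum_i (F^`M(i).@[p] - F.@[p] * u i) * v i =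
      F.@[p] * pairing (grad_loglik F u p) v.
    rewrite /pairing mulr_sumr; apply: eq_bigr => i _.
    by rewrite mulrA; congr (_ * _); rewrite /grad_loglik mulrBr mulrCA divff ?mulr1.
  split=> [->|/eqP]; first by rewrite mulr0.
  by rewrite mulf_eq0 (negbTE Fp) => /eqP.
rewrite -(basis_zclosed bY) //; split.
  move=> [[Yp [e' [/(var_dim_uniq dimY) <- ld]]] [Fp cp]]; rewrite TE // in ld cp.
  split=> //; have [l1 l2] := ld; split=> //; split=> //; split; first exact/eqP.
  by move=> v /cp /crit; apply.
move=> [Yp [l1 [l2 [/eqP Fp cp]]]]; split.
  by split=> //; exists e; rewrite TE.
split=> // v; rewrite TE // => /cp; exact: (crit v Fp).2.
Qed.

Local Notation I0 := ('I_n + unit)%type.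
Local Notation I1 := (I0 + 'I_n)%type.

Lemma definable_indep k : definable (fun x : I1 -> C => has_indep k (Tb (fun i => x (inr i)))).
Proof.
pose I2 := (I1 + ('I_k * 'I_n + 'I_n * 'I_k))%type.
suff d : definable (fun x : I2 -> C =>
    (forall ij : 'I_k * 'I_k, \sum_l x (inr (inl (ij.1, l))) * x (inr (inr (l, ij.2)))
      - (ij.1 == ij.2)%:R = 0) /\
    forall ja : 'I_k * 'I_r, \sum_i (b ja.2)^`M(i).@[fun l => x (inl (inr l))] *
      x (inr (inl (ja.1, i))) = 0).
  have := definable_ex d; apply: definable_ext => x; rewrite has_indep_inverse.
  split=> -[y [h1 h2]]; exists y; split=> //.
    by move=> j a; apply: (h2 (j, a)).
  by move=> [j a]; apply: h2.
apply: definable_and; apply: definable_fin => -[i j] /=; apply: definable_eq0.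
  apply: poly_funB; last exact: poly_fun_const.
  by apply: poly_fun_sum => l; apply: poly_funM; apply: poly_fun_var.
apply: poly_fun_sum => l; apply: poly_funM; last exact: poly_fun_var.
by apply: poly_fun_meval => m; apply: poly_fun_var.
Qed.

Lemma definable_critical i0 : definable (fun x : I0 -> C =>
  exists p, critical F Y (fun i => x (inl i)) p /\ p i0 = x (inr tt)).
Proof.
suff d : definable (fun x : I1 -> C =>
    critical F Y (fun i => x (inl (inl i))) (fun i => x (inr i)) /\
    x (inr i0) - x (inl (inr tt)) = 0).
  have := definable_ex d; apply: definable_ext => x.
  split=> -[p [cp h]]; exists p; split=> //.
    by apply/eqP; rewrite -subr_eq0; apply/eqP.
  by rewrite /join h subrr.
have pv (I : finType) (i : I) := @poly_fun_var C I i.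
apply: definable_and; last by apply: definable_eq0; apply: poly_funB.
have evp (I : finType) (f : 'I_n -> I) (p : {mpoly C[n]}) :
    poly_fun (fun x : I -> C => p.@[fun i => x (f i)]).
  by apply: poly_fun_meval => i; apply: pv.
suff d : definable (fun x : I1 -> C =>
  (forall a, (b a).@[fun i => x (inr i)] = 0) /\
  has_indep e (Tb (fun i => x (inr i))) /\ ~ has_indep e.+1 (Tb (fun i => x (inr i))) /\
  ~ F.@[fun i => x (inr i)] = 0 /\
  forall v, Tb (fun i => x (inr i)) v ->
    \sum_i (F^`M(i).@[fun i => x (inr i)] - F.@[fun i => x (inr i)] * x (inl (inl i))) * v i = 0).
  by move: d; apply: definable_ext => x; rewrite criticalE.
apply: definable_and; first by apply: definable_fin => a; apply: definable_eq0.
apply: definable_and; first exact: definable_indep.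
apply: definable_and; first by apply: definable_not; apply: definable_indep.
apply: definable_and; first by apply: definable_not; apply: definable_eq0.
pose I3 := (I1 + 'I_n)%type.
suff d : definable (fun x : I3 -> C =>
    (forall a, \sum_i (b a)^`M(i).@[fun i => x (inl (inr i))] * x (inr i) = 0) ->
    \sum_i (F^`M(i).@[fun i => x (inl (inr i))] - F.@[fun i => x (inl (inr i))] *
      x (inl (inl (inl i)))) * x (inr i) = 0).
  exact: (definable_all d).
apply: definable_imp.
  apply: definable_fin => a; apply: definable_eq0; apply: poly_fun_sum => i.
  by apply: poly_funM; [apply: (evp _ (fun i => inl (inr i)))|apply: pv].
apply: definable_eq0; apply: poly_fun_sum => i; apply: poly_funM; last exact: pv.
apply: poly_funB; first exact: (evp _ (fun i => inl (inr i))).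
by apply: poly_funM; [apply: (evp _ (fun i => inl (inr i)))|apply: pv].
Qed.

Hypothesis mld : MLD_one F Y.

Lemma rational_MLE : exists (A : 'I_n -> {mpoly C[n]}) B, B != 0 /\
  generic (fun u => B.@[u] != 0 /\ critical F Y u (rval_at A B u) /\
    forall q, critical F Y u q -> q = rval_at A B u).
Proof.
pose G i u t := exists p, critical F Y u p /\ p i = t.
have rat i : exists ab : {mpoly C[n]} * {mpoly C[n]}, ab.2 != 0 /\
    generic (fun u => ab.2.@[u] != 0 /\ G i u (ab.1.@[u] / ab.2.@[u])).
  have [|a [c [c0 g]]] := @definable_function_rational C n (G i) (definable_critical i).
    apply: generic_imp mld => u [p [cp up]]; exists (p i); split; first by exists p.
    by move=> t [q [/up -> ->]].
  by exists (a, c).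
have [ab abP] := choice rat.
pose B := \prod_i (ab i).2.
pose A i := (ab i).1 * \prod_(j | j != i) (ab j).2.
exists A, B; split; first by apply/prodf_neq0 => i _; case: (abP i).
have gab : generic (fun u => forall i, (ab i).2.@[u] != 0 /\
    G i u ((ab i).1.@[u] / (ab i).2.@[u])).
  by apply: generic_fin => i; case: (abP i).
apply: generic_imp (genericI mld gab) => u [[p [cp up]] gu].
have Bu : B.@[u] != 0.
  by rewrite rmorph_prod; apply/prodf_neq0 => i _; case: (gu i).
have <- : p = rval_at A B u; last by [].
apply: funext => i; have [ai [q [/up -> ->]]] := gu i.
pose w := \prod_(j | j != i) (ab j).2.
have BE : B = (ab i).2 * w by rewrite /B (bigD1 i).
have w0 : w.@[u] != 0 by move: Bu; rewrite BE mevalM mulf_eq0 negb_or => /andP[].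
have -> : rval_at A B u i = ((ab i).1 * w).@[u] / ((ab i).2 * w).@[u] by rewrite -BE.
by rewrite !mevalM -mulf_div divff // mulr1.
Qed.

End RationalMLE.

Lemma cone_euler (R : realType) n (Y : ('I_n -> R[i]) -> Prop) f p :
  irr_cone Y -> vanishing Y f -> Y p -> \sum_i f^`M(i).@[p] * p i = 0.
Proof.
move=> [_ sc] Yf Yp; pose io : {rmorphism R[i] -> {poly R[i]}} := (@polyC R[i] \o idfun)%FUN.
pose g i : {poly R[i]} := (p i)%:P * 'X.
have q0 : mmap io g f = 0.
  apply/eqP; apply: contraT => /poly_nonroot[t]; rewrite mmap_horner => /negP; case.
  apply/eqP; rewrite -[RHS](Yf _ (sc t p Yp)) /meval; congr (mmap _ _ f).
  by apply: funext => i; rewrite /g !hornerE mulrC.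
have dC c : (io c)^`() = 0 by exact: derivC.
have := congr1 (fun q : {poly R[i]} => q^`().[1]) q0.
rewrite /= (chain_rule (@derivD _) (@derivM _) dC) deriv0 horner0 horner_sum => e.
rewrite -[RHS]e; apply: eq_bigr => i _; rewrite hornerM mmap_horner.
rewrite /g derivM derivC mul0r add0r derivX mulr1 hornerC; congr (_ * _).
by rewrite /meval; congr (mmap _ _ _); apply: funext => j; rewrite !hornerE.
Qed.

Section FirstDirection.
Variables (R : realType) (n : nat).
Local Notation C := R[i].
Local Notation K := {fraction {mpoly C[n]}}.
Variables (F : {mpoly C[n]}) (d : nat) (Y : ('I_n -> C) -> Prop).
Hypothesis hF : homogeneous d F.
Hypothesis cone : irr_cone Y.
Variables (r : nat) (b : 'I_r -> {mpoly C[n]}).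
Hypothesis bY : vanishing_basis Y b.
Variables (A : 'I_n -> {mpoly C[n]}) (B : {mpoly C[n]}).
Hypothesis B0 : B != 0.
Hypothesis gen : generic (fun u => B.@[u] != 0 /\ critical F Y u (rval_at A B u)).
Local Notation phi := (rfrac A B).
Local Notation ev := (mmap (cst C n) phi).
Local Notation X := (@fX C n).

Let irrY : irreducible_closed Y. Proof. by case: cone. Qed.
Let cY : zclosed Y. Proof. by case: irrY. Qed.

Let ev_zero G : (forall p, Y p -> G.@[p] = 0) -> ev G = 0.
Proof.
move=> h; apply: evals_eq0; apply: generic_imp gen => u [Bu [[Yp _] _]] v.
by move/evals_uniq => /(_ _ (evals_mmap _ (evals_rfrac A Bu))) ->; apply: h.
Qed.

Let ev_neq0 : ev F != 0.
Proof.
have [u [Bu [_ [Fp _]]]] := generic_ex gen; apply: contraNneq Fp => e.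
by have := evals_mmap F (evals_rfrac A Bu); rewrite e => /evals0 ->.
Qed.

Let J : 'M[K]_(r, n) := \matrix_(a, i) ev (b a)^`M(i).

Let evalJ u : B.@[u] != 0 -> evalmx u J (grads b (rval_at A B u)).
Proof. by move=> Bu a i; rewrite !mxE; apply: evals_mmap; apply: evals_rfrac. Qed.

Lemma MLE_conormal : exists c : 'I_r -> K, forall i,
  ev F^`M(i) / ev F - X i = \sum_a c a * ev (b a)^`M(i).
Proof.
pose g : 'rV[K]_n := \row_i (ev F^`M(i) / ev F - X i).
suff /submxP[c cE] : (g <= J)%MS.
  exists (fun a => c 0 a) => i; have /rowP/(_ i) := cE; rewrite !mxE => ->.
  by apply: eq_bigr => a _; rewrite mxE.
rewrite submxE; apply/eqP/rowP => j; rewrite [RHS]mxE; apply: evals_eq0.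
apply: generic_imp (genericI gen (evalmx_generic (cokermx J))).
move=> u [[Bu [[Yp _] [Fp cp]]] [N hN]] v.
have JN : grads b (rval_at A B u) *m N = 0.
  apply: evalmx_uniq (evalmxM (evalJ Bu) hN) _; rewrite mulmx_coker.
  by rewrite -(map_mx0 (cst C n)); apply: evalmx_cst.
have ge : evals u ((g *m cokermx J) 0 j)
    (\sum_i grad_loglik F u (rval_at A B u) i * N i j).
  rewrite mxE; apply: evals_sum => i; apply: evalsM; last exact: hN.
  by rewrite mxE; apply: evals_grad_loglik.
move/evals_uniq => /(_ _ ge) ->; apply: cp (fun i => N i j) _.
apply/(tangent_grads bY) => //; apply/colP => a; rewrite [RHS]mxE.
have e : (grads b (rval_at A B u) *m N) a j = 0 by rewrite JN mxE.
rewrite -[RHS]e [LHS]mxE [RHS]mxE; apply: eq_bigr => i _.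
by rewrite [(rowv _)^T _ _]mxE [rowv _ _ _]mxE.
Qed.

Let b0 a : ev (b a) = 0.
Proof. by apply: ev_zero => p; apply: bY.1. Qed.

Lemma closure_MLE p : zclosure (rimage A B) p <-> Y p.
Proof.
have sub : subset (zclosure (rimage A B)) Y.
  move=> q Yq; apply/(zclosure_id cY) => f Yf; move: q Yq.
  by apply/vanishing_rimage => //; apply: ev_zero.
split; first exact: sub.
move=> Yp; apply: contrapT => np.
have [u0 [_ [[_ [e [dimY _]]] _]]] := generic_ex gen.
have rkJ : (\rank J + e = n)%N.
  have [u [[Bu [[Yq [e' [/(var_dim_uniq dimY) <- ld]]] _]] h]] :=
    generic_ex (genericI gen (evalmx_rank J)).
  rewrite -(h _ (evalJ Bu)) (lin_dim_uniq ld (lin_dim_tangent bY Yq)) subnKC //.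
  exact: rank_leq_col.
have [c cE] := MLE_conormal.
have := conormal_rank (@fDD C n) (@fDM C n) (@fDC C n) (@fDX C n) ev_neq0 cE.
rewrite -/J -{1}rkJ addnC leq_add2r => le.
have ch : has_chain (\rank (rjac A B)).+1 Y.
  by apply: has_chain_snoc irrY sub _ (has_chain_rimage A B0); exists p.
by have [_] := dimY; apply; apply: has_chain_le ch.
Qed.

Let euler_ev : \sum_i ev F^`M(i) * phi i = cst C n d%:R * ev F.
Proof.
rewrite -mmapZ -(euler_homogeneous hF) /euler raddf_sum /=; apply: eq_bigr => i _.
by rewrite [RHS]rmorphM /= mmapX mmap1U mulrC.
Qed.

Let cone_ev a : \sum_i ev (b a)^`M(i) * phi i = 0.
Proof.
rewrite -[RHS](ev_zero (G := \sum_i 'X_i * (b a)^`M(i))).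
  rewrite raddf_sum /=; apply: eq_bigr => i _.
  by rewrite [RHS]rmorphM /= mmapX mmap1U mulrC.
move=> p Yp; rewrite raddf_sum /= -[RHS](cone_euler cone (bY.1 a) Yp).
by apply: eq_bigr => i _; rewrite mevalM mevalXU mulrC.
Qed.

Lemma MLE_logderiv j : fD j (ev F) = - ev F * phi j.
Proof.
have [c cE] := MLE_conormal.
exact: (conormal_logderiv (@fDD C n) (@fDM C n) (@fDC C n) (@fDX C n) ev_neq0 b0 cE
  cone_ev euler_ev).
Qed.

Lemma MLE_euler : \sum_j X j * fD j (ev F) = - cst C n d%:R * ev F.
Proof.
have [c cE] := MLE_conormal.
under eq_bigr do rewrite MLE_logderiv mulrCA.
rewrite -mulr_sumr (conormal_pairing ev_neq0 cE cone_ev euler_ev).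
by rewrite !mulNr mulrC.
Qed.

Lemma variety_to_solution : exists Phi : {mpoly C[n]} * {mpoly C[n]},
  homaloidal_sol F Phi /\
  generic (fun u => [/\ rdef Phi u, critical F Y u (neg_grad_log Phi u) &
    rval Phi u = F.@[neg_grad_log Phi u]]) /\
  (forall p, Y p <-> zclosure (image_ngl Phi) p).
Proof.
have [P [Q [P0 Q0 PQ [[d1 hP] [d2 hQ]]]]] := homogeneous_quotient ev_neq0 MLE_euler.
have phiE i : rfrac (ngl_num P Q) (P * Q) i = phi i.
  have := fD_fraction P0 Q0 i; rewrite -PQ MLE_logderiv.
  have nF : - ev F != 0 by rewrite oppr_eq0.
  by move/(mulfI nF)/esym.
have g : generic (fun u => [/\ rdef (P, Q) u, critical F Y u (neg_grad_log (P, Q) u) &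
    rval (P, Q) u = F.@[neg_grad_log (P, Q) u]]).
  have PQ0 : P * Q != 0 by rewrite mulf_neq0.
  apply: generic_imp (genericI gen (generic_nz PQ0)) => u [[Bu cp] PQu].
  have ptE : neg_grad_log (P, Q) u = rval_at A B u.
    rewrite neg_grad_logE //; apply: funext => i.
    apply: evals_uniq (evals_rfrac A Bu i).
    by rewrite -phiE; apply: evals_rfrac.
  rewrite rdefE ptE; split=> //.
  have [h _] := Phi_at PQu; apply: evals_uniq h _; rewrite -PQ.
  by apply: evals_mmap; apply: evals_rfrac.
exists (P, Q); split.
  split; last by apply: generic_imp g => u [].
  by split=> //; split=> //; split; [exists d1 | exists d2].
split=> // p; rewrite -closure_MLE image_nglE //.
have PQ0 : P * Q != 0 by rewrite mulf_neq0.
have phiE' : rfrac (ngl_num P Q) (P * Q) = phi by apply: funext => i; apply: phiE.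
split=> h f /vanishing_zclosure; rewrite vanishing_rimage // => e.
  by apply: h; apply/vanishing_zclosure; rewrite vanishing_rimage // -phiE'.
by apply: h; apply/vanishing_zclosure; rewrite vanishing_rimage // phiE'.
Qed.

End FirstDirection.

(* Theorem 3.5.  Irreducible projective X in P(L) are encoded by their affine
   cones Y = C_X (see NOTES.md).  The bijection X <-> Phi is stated through
   its two directions and the two round trips:
   (1) for X with MLD_F(X) = 1, Phi := F o MLE_X is a solution (any Phi with
       Phi = F o MLE_X generically), MLE_X = - grad log Phi, and
       P(closure Im(- grad log Phi)) = X;
   (2) for a solution Phi, X := P(closure Im(- grad log Phi)) is an
       irreducible projective variety with MLD_F(X) = 1,
       MLE_X = - grad log Phi and F o MLE_X = Phi. *)
Theorem theorem3p5 (R : realType) (n : nat) (F : {mpoly R[i][n]}) (d : nat) :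
  homogeneous d F ->
  (forall Y : ('I_n -> R[i]) -> Prop,
     irr_cone Y -> MLD_one F Y ->
     exists Phi : {mpoly R[i][n]} * {mpoly R[i][n]},
       homaloidal_sol F Phi /\
       general (fun u => rdef Phi u /\
                 forall p, critical F Y u p -> rval Phi u = F.@[p]) /\
       general (fun u => rdef Phi u /\ critical F Y u (neg_grad_log Phi u)) /\
       (forall p, Y p <-> zclosure (image_ngl Phi) p)) /\
  (forall Phi : {mpoly R[i][n]} * {mpoly R[i][n]},
     homaloidal_sol F Phi ->
     irr_cone (zclosure (image_ngl Phi)) /\
     MLD_one F (zclosure (image_ngl Phi)) /\
     general (fun u => rdef Phi u /\
               critical F (zclosure (image_ngl Phi)) u (neg_grad_log Phi u)) /\
     general (fun u => rdef Phi u /\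
               forall p, critical F (zclosure (image_ngl Phi)) u p ->
                         rval Phi u = F.@[p])).
Proof.
move=> hF; split=> [Y cone mld|[P Q] sol]; last exact: solution_to_variety.
have [r [b bY]] := vanishing_basis_ex Y.
have [_ [p [[[_ [e [dimY _]]] _] _]]] := generic_ex mld.
have cY : zclosed Y by case: cone => -[].
have [A [B [B0 gen]]] := rational_MLE bY cY dimY mld.
have [|Phi [sol [g clo]]] := variety_to_solution hF cone bY B0 (A := A).
  by apply: generic_imp gen => u [Bu [cu _]].
exists Phi; split=> //; split; [|split=> //].
  apply: generic_imp (genericI g gen) => u [[du cu e'] [Bu [_ uni]]]; split=> // q cq.
  by rewrite e' (uni _ cq) (uni _ cu).
by apply: generic_imp g => u [].
Qed.
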